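(* An abelian group $G$ is a B+E-group if, and only if, it embeds in an abelian group that is generalized Bassian.
   Context: All groups are abelian. A group $G$ is Bassian (respectively, generalized Bassian) if, for every subgroup $N$ of $G$, the existence of an injective homomorphism $G\to G/N$ implies that $N=\{0\}$ (respectively, that $N$ is a direct summand of $G$). A torsion group $E$ is elementary if, for every prime $p$, its $p$-primary component $E_p$ satisfies $pE_p=0$. A group $G$ is a B+E-group if it decomposes as $G=A\oplus E$, where $A$ is Bassian and $E$ is elementary. *)

(* Defs.v *)
From HB Require Import structures.
From mathcomp Require Import all_boot all_algebra.

Set Implicit Arguments.
Unset Strict Implicit.
Unset Printing Implicit Defensive.

Import GRing.Theory.
Local Open Scope ring_scope.

(* Abelian groups are zmodTypes and subgroups of G are N : zmodClosed G.  With
   classical logic and choice this loses no generality: every type is then a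
   choiceType and every Prop-valued predicate is reflected by a boolean one. *)

Definition embeds (G H : zmodType) : Prop :=
  exists f : {additive G -> H}, injective f.

Section Subgroup.
Variables (G : zmodType) (A : zmodClosed G).

Record subgroup : Type := Subgroup { subgroup_val : G; _ : subgroup_val \in A }.

HB.instance Definition _ := [isSub for subgroup_val].
HB.instance Definition _ := [Choice of subgroup by <:].
HB.instance Definition _ := [SubChoice_isSubZmodule of subgroup by <:].

End Subgroup.

Definition internal_direct_sum (G : zmodType) (A B : zmodClosed G) : Prop :=
  (forall x : G, x \in A -> x \in B -> x = 0) /\
  (forall x : G, exists a b : G, [/\ a \in A, b \in B & x = a + b]).

Definition direct_summand (G : zmodType) (N : zmodClosed G) : Prop :=
  exists K : zmodClosed G, internal_direct_sum N K.

(* Quotient.quot N is the quotient group G / N: despite its place in a file on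
   ring quotients, it only requires G to be a zmodType. *)
Definition Bassian (G : zmodType) : Prop :=
  forall N : zmodClosed G,
    embeds G (Quotient.quot N) -> forall x : G, x \in N -> x = 0.

Definition generalized_Bassian (G : zmodType) : Prop :=
  forall N : zmodClosed G, embeds G (Quotient.quot N) -> direct_summand N.

Definition torsion (G : zmodType) : Prop :=
  forall x : G, exists2 n : nat, (0 < n)%N & x *+ n = 0.

Definition primary_component (G : zmodType) (p : nat) (x : G) : Prop :=
  exists k : nat, x *+ (p ^ k) = 0.

Definition elementary (E : zmodType) : Prop :=
  torsion E /\
  forall p : nat, prime p ->
    forall x : E, primary_component p x -> x *+ p = 0.

Definition BE_group (G : zmodType) : Prop :=
  exists A E : zmodClosed G,
    [/\ internal_direct_sum A E,
        Bassian (subgroup A) & elementary (subgroup E)].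

(* Main.v *)
Require Import Defs.
From mathcomp Require Import all_boot all_order all_algebra.
From HB Require Import structures.
From mathcomp Require Import boolp classical_sets functions.
From mathcomp Require Import zify.

Set Implicit Arguments.
Unset Strict Implicit.
Unset Printing Implicit Defensive.

Import Order.TTheory GRing.Theory Num.Theory.
Local Open Scope ring_scope.

(** Both conditions are equivalent to an intrinsic one, [finite_invariants]: [G]
    has finite torsion-free rank and, writing [T_p] for its [p]-primary
    component, [p T_p] is finite for every prime [p]. This condition is clearly
    inherited by subgroups.

    A generalized Bassian [H] satisfies it. The tool is
    [generalized_Bassian_split]: given homomorphisms [s, i : H -> D] and a
    subgroup [F] on which [i] is injective and whose image under [s] contains
    both images, [H] embeds in its quotient by [F & ker s], which therefore must
    split off. If the rank is infinite, take for [F] a free subgroup of countable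
    rank, for [D] a rational vector space of countable dimension, for [s] an
    extension of a surjection of [F] onto [D] and for [i] an extension of an
    embedding of [F] in [D]; a splitting would embed [D] in a free group. If
    [p T_p] is infinite, consider the elements of order [p] that are divisible by
    [p ^ k]. Either they are infinite in number for all [k], and the same argument
    works with a direct sum of cyclic [p]-groups; or they become finite in number
    only after some [k > 0], and [H] has as a direct summand an infinite sum of
    cyclic groups of order [p ^ k.+1], to which a shift of generators applies; or
    they are finite in number for [k = 1], and [H] contains a nonzero divisible
    [p]-group, to which multiplication by [p] applies.

    Conversely let [G] have finite invariants. At each prime there is a projection
    of [G] on an elementary [p]-subgroup of finite index in [T_p] which kills a
    given finite maximal independent family. The sum [E] of these subgroups and
    the intersection [A] of the kernels of the projections decompose [G], and [A]
    has finite rank and finite primary components, which makes it Bassian by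
    counting. For the embedding in a generalized Bassian group, [A] is enlarged
    in its divisible hull to a group [B] of the same kind in which all elements
    of order [p] are multiples of [p]. An embedding of [B + E] in its quotient by
    [N] makes [N] a torsion group that avoids all multiples [p T_p], by counting
    again; hence [N] avoids [B], and it is a direct summand because the quotient
    by [B] is elementary. *)

(** * Subgroups as predicates *)

(** Subgroups as propositions rather than as boolean [zmodClosed] predicates:
    sums, images, ranges and spans are given by existential statements. *)
Definition subgrp (G : zmodType) (P : G -> Prop) : Prop :=
  P 0 /\ forall x y, P x -> P y -> P (x - y).

Definition divisible (D : zmodType) : Prop :=
  forall (n : nat) (x : D), (0 < n)%N -> exists y, y *+ n = x.

Section SubgroupPredicates.
Variables (G : zmodType) (P : G -> Prop).
Hypothesis sP : subgrp P.

Lemma subgrp0 : P 0.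
Proof. by case: sP. Qed.

Lemma subgrpB x y : P x -> P y -> P (x - y).
Proof. by case: sP => _; apply. Qed.

Lemma subgrpN x : P x -> P (- x).
Proof. by move=> Px; rewrite -sub0r; apply: subgrpB => //; apply: subgrp0. Qed.

Lemma subgrpD x y : P x -> P y -> P (x + y).
Proof. by move=> Px Py; rewrite -[y]opprK; apply: subgrpB => //; apply: subgrpN. Qed.

Lemma subgrpMn x n : P x -> P (x *+ n).
Proof.
move=> Px; elim: n => [|n IHn]; first exact: subgrp0.
by rewrite mulrS; apply: subgrpD.
Qed.

Lemma subgrpMz x (c : int) : P x -> P (x *~ c).
Proof. by case: c => n Px; [|apply: subgrpN]; apply: subgrpMn. Qed.

Lemma subgrp_absz x (c : int) : P (x *~ c) -> P (x *+ `|c|%N).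
Proof.
case: c => n // Pxc; rewrite -[x *+ _]opprK.
exact: (subgrpN Pxc).
Qed.

Lemma subgrp_addKr x y : P x -> P (x + y) -> P y.
Proof. by move=> Px Pxy; rewrite -[y](addKr x) addrC; apply: subgrpB. Qed.

(** Bezout's identity; taking for [P] a trivial group, a range or a sum turns it
    into a statement about orders, divisibility or decompositions. *)
Lemma subgrp_gcd x a b : P (x *+ a) -> P (x *+ b) -> P (x *+ gcdn a b).
Proof.
case: (posnP a) => [-> _|a_gt0 Pa Pb]; first by rewrite gcd0n.
have [u _ /dvdnP [v def_v]] := Bezoutl b a_gt0.
have -> : x *+ gcdn a b = x *+ a *+ v - x *+ b *+ u.
  by rewrite -!mulrnA [(a * v)%N]mulnC -def_v mulrnDr [(b * u)%N]mulnC addrK.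
by apply: subgrpB; apply: subgrpMn.
Qed.

Lemma subgrp_coprime x a b : coprime a b -> P (x *+ a) -> P (x *+ b) -> P x.
Proof. by move=> /eqP co_ab Pa Pb; have := subgrp_gcd Pa Pb; rewrite co_ab. Qed.

Lemma ex_zmodClosed : exists N : zmodClosed G, forall x, x \in N <-> P x.
Proof.
pose S : G -> bool := fun x => `[< P x >].
have closedS : zmod_closed S.
  split; first by apply/asboolP; apply: subgrp0.
  by move=> x y /asboolP Px /asboolP Py; apply/asboolP; apply: subgrpB.
pose N : zmodClosed G := HB.pack S (GRing.isZmodClosed.Build G S closedS).
by exists N => x; split=> /asboolP.
Qed.

End SubgroupPredicates.

Lemma mulrn_eq0_gcd (G : zmodType) (x : G) a b :
  x *+ a = 0 -> x *+ b = 0 -> x *+ gcdn a b = 0.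
Proof.
apply: (@subgrp_gcd G (fun x => x = 0)); split=> // y z -> ->.
by rewrite subr0.
Qed.

Lemma mulrn_eq0_coprime (G : zmodType) (x : G) a b :
  coprime a b -> x *+ a = 0 -> x *+ b = 0 -> x = 0.
Proof. by move=> /eqP co_ab xa xb; have := mulrn_eq0_gcd xa xb; rewrite co_ab. Qed.

Lemma subgrp_zmodClosed (G : zmodType) (N : zmodClosed G) :
  subgrp (fun x => x \in N).
Proof. by split=> [|x y]; [apply: rpred0 | apply: rpredB]. Qed.

Lemma subgrpI (G : zmodType) (P Q : G -> Prop) :
  subgrp P -> subgrp Q -> subgrp (fun x => P x /\ Q x).
Proof.
move=> sP sQ; split; first by split; apply: subgrp0.
by move=> x y [Px Qx] [Py Qy]; split; apply: subgrpB.
Qed.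

Lemma subgrpS (G : zmodType) (P Q : G -> Prop) :
  subgrp P -> subgrp Q -> subgrp (fun x => exists y z, [/\ P y, Q z & x = y + z]).
Proof.
move=> sP sQ; split.
  by exists 0, 0; split; rewrite ?addr0 //; apply: subgrp0.
move=> _ _ [y [z [Py Qz ->]]] [y' [z' [Py' Qz' ->]]].
exists (y - y'), (z - z'); split; try exact: subgrpB.
by rewrite opprD addrACA.
Qed.

Lemma subgrp_img (G H : zmodType) (f : {additive G -> H}) (P : G -> Prop) :
  subgrp P -> subgrp (fun y => exists2 x, P x & y = f x).
Proof.
move=> sP; split; first by exists 0; rewrite ?raddf0 //; apply: subgrp0.
by move=> _ _ [x Px ->] [y Py ->]; exists (x - y); rewrite ?raddfB //; apply: subgrpB.
Qed.

Lemma subgrp_pre (G H : zmodType) (f : {additive G -> H}) (P : H -> Prop) :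
  subgrp P -> subgrp (fun x => P (f x)).
Proof.
move=> sP; split; first by rewrite raddf0; apply: subgrp0.
by move=> x y Px Py; rewrite raddfB; apply: subgrpB.
Qed.

Lemma subgrp_all (G : zmodType) : subgrp (fun _ : G => True).
Proof. by []. Qed.

Lemma subgrp_eq0 (G : zmodType) : subgrp (fun x : G => x = 0).
Proof. by split=> // x y -> ->; rewrite subr0. Qed.

Lemma subgrp_range (G H : zmodType) (f : {additive G -> H}) :
  subgrp (fun y => exists x, y = f x).
Proof.
split; first by exists 0; rewrite raddf0.
by move=> _ _ [x ->] [y ->]; exists (x - y); rewrite raddfB.
Qed.

Lemma ex_additive (G H : zmodType) (f : G -> H) :
  {morph f : x y / x - y} -> exists g : {additive G -> H}, g =1 f.
Proof.
move=> fB.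
pose g : {additive G -> H} := HB.pack f (GRing.isZmodMorphism.Build G H f fB).
by exists g.
Qed.

Lemma quotP (G : zmodType) (N : zmodClosed G) :
  exists pi : {additive G -> Quotient.quot N},
    (forall y, exists x, pi x = y) /\ (forall x, pi x = 0 <-> x \in N).
Proof.
exists (\pi_(Quotient.quot N)%qT); split=> [y|x].
  by exists (repr y); exact: reprK.
rewrite -[x in x \in N]subr0 Quotient.idealrBE raddf0.
by split=> /eqP.
Qed.

Lemma quotient (G : zmodType) (P : G -> Prop) : subgrp P ->
  exists (Q : zmodType) (pi : {additive G -> Q}),
    (forall y, exists x, pi x = y) /\ (forall x, pi x = 0 <-> P x).
Proof.
move=> /ex_zmodClosed [N NP]; have [pi [pi_surj pi0]] := quotP N.
by exists (Quotient.quot N), pi; split=> // x; rewrite pi0.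
Qed.

(** * Complements and extension of homomorphisms *)

Section MaximalDisjoint.
Variables (G : zmodType) (S U V : G -> Prop).
Hypotheses (sS : subgrp S) (sU : subgrp U).
Hypotheses (US : forall x, U x -> S x) (UV0 : forall x, U x -> V x -> x = 0).

Let good (X : set G) : Prop :=
  [/\ subgrp X, forall x, U x -> X x, forall x, X x -> S x
    & forall x, X x -> V x -> x = 0].

(** Zorn's lemma, with maximality in usable form: a new element [h] can only be
    refused because some [m + c h] falls into [V]. *)
Lemma maximal_disjoint : exists M : G -> Prop,
  [/\ subgrp M, forall x, U x -> M x, forall x, M x -> S x,
      forall x, M x -> V x -> x = 0
    & forall h, S h -> ~ M h ->
        exists m (c : int), [/\ M m, V (m + h *~ c) & m + h *~ c != 0]].
Proof.
(* The empty set has to satisfy [P], being the union of the empty chain. *)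
pose P : set (set G) := fun X => X = set0 \/ good X.
have chainP (F : set (set G)) : (F `<=` P)%classic ->
    total_on F subset -> P (\bigcup_(X in F) X)%classic.
  move=> FP totF.
  have [[X0 FX0 gX0]|noX] := pselect (exists2 X, F X & good X); last first.
    left; apply/seteqP; split=> // x [X FX Xx].
    by case: (FP X FX) => [Xe|gX]; [rewrite Xe in Xx | case: noX; exists X].
  have goodF X x : F X -> X x -> good X.
    by move=> FX Xx; case: (FP X FX) => // Xe; rewrite Xe in Xx.
  right; split.
  - split; first by exists X0 => //; case: gX0 => sX0 _ _ _; apply: subgrp0.
    move=> x y [X FX Xx] [Y FY Yy].
    have [[sX _ _ _] [sY _ _ _]] := (goodF X x FX Xx, goodF Y y FY Yy).
    by case: (totF X Y FX FY) => sub; [exists Y | exists X] => //;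
      apply: subgrpB => //; apply: sub.
  - by move=> x Ux; exists X0 => //; case: gX0 => _ UX0 _ _; apply: UX0.
  - by move=> x [X FX Xx]; case: (goodF X x FX Xx) => _ _ XS _; apply: XS.
  - by move=> x [X FX Xx]; case: (goodF X x FX Xx) => _ _ _; apply.
have [M [PM maxM]] := Zorn_bigcup chainP.
have gU : good U by split.
have gM : good M.
  case: PM => // M0; case: (maxM U); last by right.
  split; first by rewrite M0.
  by move=> /(_ 0 (subgrp0 sU)); rewrite M0.
have [sM UM MS MV0] := gM; exists M; split=> // h Sh nMh.
pose X x := exists m (c : int), M m /\ x = m + h *~ c.
have MX x : M x -> X x by move=> Mx; exists x, 0; rewrite mulr0z addr0.
have [//|notgX] := pselect (exists m (c : int),
  [/\ M m, V (m + h *~ c) & m + h *~ c != 0]).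
case: (maxM X).
  split; first exact: MX.
  by move=> /(_ h) XM; apply: nMh; apply: XM; exists 0, 1; rewrite add0r; split=> //; apply: subgrp0.
right; split.
- split; first by apply: MX; apply: subgrp0.
  move=> _ _ [m [c [Mm ->]]] [m' [c' [Mm' ->]]]; exists (m - m'), (c - c').
  by rewrite mulrzBr opprD addrACA; split=> //; apply: subgrpB.
- by move=> x Ux; apply: MX; apply: UM.
- move=> _ [m [c [Mm ->]]]; apply: subgrpD => //; first exact: MS.
  exact: subgrpMz.
- move=> x [m [c [Mm def_x]]] Vx; apply/eqP/negPn/negP => nz_x.
  by apply: notgX; exists m, c; rewrite -def_x.
Qed.

End MaximalDisjoint.

(** For a maximal [M] disjoint from [V] the quotient by [M + V] is torsion, so it
    is enough that [h] lies in [M + V] when [q h] does for a prime [q]. The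
    hypothesis on primes allows [h] to be moved by an element of [V] until [q h]
    lies in [M]; maximality then gives [m + c h] in [V] with [c] prime to [q],
    and Bezout puts [h] in [M + V]. *)
Lemma complement (G : zmodType) (S U V : G -> Prop) :
  subgrp S -> subgrp U -> subgrp V ->
  (forall x, U x -> S x) -> (forall x, V x -> S x) ->
  (forall x, U x -> V x -> x = 0) ->
  (forall M : G -> Prop, subgrp M -> (forall x, U x -> M x) ->
     (forall x, M x -> V x -> x = 0) ->
     forall q h m f, prime q -> S h -> M m -> V f -> h *+ q = m + f ->
     exists2 f', V f' & f = f' *+ q) ->
  exists M : G -> Prop,
    [/\ subgrp M, forall x, U x -> M x, forall x, M x -> S x,
        forall x, M x -> V x -> x = 0
      & forall h, S h -> exists f m, [/\ V f, M m & h = f + m]].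
Proof.
move=> sS sU sV US VS UV0 divV.
have [M [sM UM MS MV0 maxM]] := maximal_disjoint sS sU US UV0.
exists M; split=> //.
pose W x := exists f m, [/\ V f, M m & x = f + m].
have sW : subgrp W by apply: subgrpS.
have MW x : M x -> W x.
  by move=> Mx; exists 0, x; rewrite add0r; split=> //; apply: subgrp0.
have VW x : V x -> W x.
  by move=> Vx; exists x, 0; rewrite addr0; split=> //; apply: subgrp0.
have stepW q h : prime q -> S h -> W (h *+ q) -> W h.
  move=> pr_q Sh [f [m [Vf Mm def_qh]]].
  have [f' Vf' def_f] := divV M sM UM MV0 q h m f pr_q Sh Mm Vf
    (etrans def_qh (addrC _ _)).
  have Mh' : M ((h - f') *+ q) by rewrite mulrnBl def_qh def_f addrAC subrr add0r.
  suff Wh' : W (h - f') by rewrite -[h](subrK f'); apply: subgrpD => //; apply: VW.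
  have [/MW //|nMh'] := pselect (M (h - f')).
  have [m1 [c [Mm1 Vf1 nz_f1]]] := maxM (h - f') (subgrpB sS Sh (VS _ Vf')) nMh'.
  have Wc : W ((h - f') *+ `|c|%N).
    by apply: (subgrp_absz sW); apply: (subgrp_addKr sW (MW _ Mm1)); apply: VW.
  (* If [q] divides [c] then [m1 + c (h - f')] lies in [M & V], against [nz_f1]. *)
  have [q_c|co_qc] := boolP (q %| `|c|)%N; last first.
    apply: (subgrp_coprime sW _ (MW _ Mh') Wc).
    by rewrite prime_coprime.
  case/eqP: nz_f1; apply: MV0 => //; apply: subgrpD => //.
  have /intdiv.dvdzP[k ->] : (q %| c)%Z by [].
  by rewrite mulrC mulrzA; apply: subgrpMz.
have torW n h : (0 < n)%N -> S h -> W (h *+ n) -> W h.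
  elim/ltn_ind: n h => n IHn h n_gt0 Sh Wnh.
  have [n_le1|n_gt1] := leqP n 1%N; first by move: Wnh; have -> : n = 1%N by lia.
  have [pr_q q_n] := (pdiv_prime n_gt1, pdiv_dvd n).
  have [k def_n] := dvdnP q_n.
  have q_gt1 := prime_gt1 pr_q.
  apply: (stepW _ _ pr_q Sh); apply: (IHn k); [nia|nia|exact: subgrpMn|].
  by rewrite -mulrnA mulnC -def_n.
move=> h Sh; have [/MW //|nMh] := pselect (M h).
have [m1 [c [Mm1 Vf1 nz_f1]]] := maxM h Sh nMh.
apply: (torW `|c|%N h _ Sh).
  rewrite absz_gt0; apply: contra_neq nz_f1 => c0.
  by move: Vf1; rewrite c0 mulr0z addr0; apply: MV0.
by apply: (subgrp_absz sW); apply: (subgrp_addKr sW (MW _ Mm1)); apply: VW.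
Qed.

Lemma projection (G : zmodType) (V M : G -> Prop) :
  subgrp V -> subgrp M -> (forall x, M x -> V x -> x = 0) ->
  (forall h, exists f m, [/\ V f, M m & h = f + m]) ->
  exists rho : {additive G -> G},
    [/\ forall h, V (rho h), forall h, M (h - rho h),
        forall f, V f -> rho f = f & forall m, M m -> rho m = 0].
Proof.
move=> sV sM MV0 dec.
have decV h : {f | V f /\ M (h - f)}.
  apply: cid; have [f [m [Vf Mm ->]]] := dec h.
  by exists f; rewrite [f + m]addrC addrK.
pose r h := proj1_sig (decV h).
have rP h : V (r h) /\ M (h - r h) := proj2_sig (decV h).
have r_uniq h f : V f -> M (h - f) -> r h = f.
  move=> Vf Mhf; have [Vr Mr] := rP h; apply/subr0_eq/MV0; last exact: subgrpB.
  suff -> : r h - f = (h - f) - (h - r h) by apply: subgrpB.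
  by rewrite opprB [RHS]addrC addrA subrK.
have rB : {morph r : x y / x - y}.
  move=> x y; have [[Vx Mx] [Vy My]] := (rP x, rP y).
  apply: r_uniq; first exact: subgrpB.
  by rewrite opprD addrACA -opprD; apply: subgrpB.
have [rho rhoE] := ex_additive rB; exists rho.
split=> h; rewrite rhoE; try by have [] := rP h.
- by move=> Vh; apply: r_uniq; rewrite ?subrr //; apply: subgrp0.
- by move=> Mh; apply: r_uniq; rewrite ?subr0 //; apply: subgrp0.
Qed.

(** Injectivity of divisible groups: the partial map [e c |-> g c] is a graph
    meeting [0 * D] trivially, and the divisible subgroup [0 * D] of [H * D] has
    a complement containing that graph. *)
Lemma divisible_extension (C H D : zmodType) (e : {additive C -> H})
    (g : {additive C -> D}) :
  divisible D -> (forall c, e c = 0 -> g c = 0) ->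
  exists g' : {additive H -> D}, forall c, g' (e c) = g c.
Proof.
move=> divD ker_eg.
pose U (z : H * D) := exists c, z = (e c, g c).
pose V (z : H * D) := z.1 = 0.
have sU : subgrp U.
  split; first by exists 0; rewrite !raddf0.
  by move=> _ _ [c ->] [c' ->]; exists (c - c'); rewrite !raddfB.
have sV : subgrp V.
  by split=> // x y; rewrite /V /= => -> ->; rewrite subr0.
have UV0 x : U x -> V x -> x = 0.
  by case=> c ->; rewrite /V /= => ec0; rewrite ec0 ker_eg.
have [//|//|M sM UM MV0 q h m f pr_q _ _ Vf _|M [sM UM _ MV0 dec]] :=
  complement (subgrp_all _) sU sV _ _ UV0.
  have [y def_y] := divD q f.2 (prime_gt0 pr_q).
  exists (0, y) => //; move: Vf def_y; rewrite /V; case: f => f1 f2 /= -> <-.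
  by rewrite (surjective_pairing ((0, y) *+ q)) !raddfMn /= mul0rn.
have [rho [rhoV rhoM rhoid rho0]] := projection sV sM MV0 (fun h => dec h I).
have gB : {morph (fun h : H => - (rho (h, 0)).2) : x y / x - y}.
  move=> x y; have -> : (x - y, 0 : D) = (x, 0) - (y, 0) by congr pair; rewrite subr0.
  by rewrite raddfB /= opprD.
have [g' g'E] := ex_additive gB; exists g' => c; rewrite g'E.
have -> : (e c, 0 : D) = (e c, g c) + (0, - g c).
  by congr pair => /=; rewrite ?addr0 ?subrr.
rewrite raddfD rho0; last by apply: UM; exists c.
by rewrite rhoid // add0r /= opprK.
Qed.

(** * Independent sequences and split kernels *)

(** If [F] maps under [s] onto a set containing the images of [s] and [i], then
    [h |-> h + f] modulo [N = F & ker s], where [f] in [F] satisfies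
    [s f = i h - s h], is a homomorphism. It is injective: if [h + f] lies in [N]
    then [h] lies in [F] and [0 = s (h + f) = i h]. Hence [N] splits off. *)
Lemma generalized_Bassian_split (H D : zmodType) (F : H -> Prop)
    (s i : {additive H -> D}) :
  generalized_Bassian H -> subgrp F ->
  (forall h, exists2 f, F f & s f = s h) ->
  (forall h, exists2 f, F f & s f = i h) ->
  (forall f, F f -> i f = 0 -> f = 0) ->
  exists K : H -> Prop,
    [/\ subgrp K, forall x, F x -> s x = 0 -> K x -> x = 0
      & forall x, F x -> exists y, [/\ F y, K y & s y = s x]].
Proof.
move=> gB sF s_s s_i inj_i.
have [N NP] := ex_zmodClosed (subgrpI sF (subgrp_pre s (@subgrp_eq0 D))).
have [pi [pi_surj pi0]] := quotP N.
have sec h : {f | F f /\ s f = i h - s h}.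
  apply: cid; have [[f Ff sf] [f' Ff' sf']] := (s_s h, s_i h).
  by exists (f' - f); rewrite raddfB /= sf sf'; split=> //; apply: subgrpB.
pose t h := proj1_sig (sec h).
have tP h : F (t h) /\ s (t h) = i h - s h := proj2_sig (sec h).
have phiB : {morph (fun h => pi (h + t h)) : x y / x - y}.
  move=> x y; apply/subr0_eq; rewrite -!raddfB; apply/pi0/NP.
  have -> : x + t x - (y + t y) = (x - y) + (t x - t y) by rewrite opprD addrACA.
  rewrite opprD addrACA subrr add0r.
  have [[[Fx sx] [Fy sy]] [Fxy sxy]] := (tP x, tP y, tP (x - y)).
  split; first by do !apply: subgrpB.
  rewrite !(raddfB s) /= sx sy sxy (raddfB s) (raddfB i) /=.
  by rewrite (opprD (s x)) addrACA -(opprD (i y)) subrr.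
have [phi phiE] := ex_additive phiB.
have inj_phi : injective phi.
  apply: raddf_inj => x; rewrite phiE => /pi0/NP [Fxt].
  have [Ft st] := tP x; rewrite raddfD /= st addrC subrK; apply: inj_i.
  by apply: (subgrp_addKr sF Ft); rewrite addrC.
have [K [NK0 decK]] := gB N (ex_intro _ phi inj_phi).
exists (fun x => x \in K); split; first exact: subgrp_zmodClosed.
  by move=> x Fx sx; apply: NK0; apply/NP.
move=> x Fx; have [n [k [Nn Kk def_x]]] := decK x.
have [Fn sn] := (NP n).1 Nn; exists k; rewrite def_x raddfD /= sn add0r.
by split=> //; apply: (subgrp_addKr sF Fn); rewrite -def_x.
Qed.

Lemma sequence_choice (T : Type) (t0 : T) (Q : nat -> T -> Prop)
    (R : seq T -> T -> Prop) :
  (forall l, (forall i, (i < size l)%N -> Q i (nth t0 l i)) ->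
     exists x, Q (size l) x /\ R l x) ->
  exists u : nat -> T, forall n, Q n (u n) /\ R (mkseq u n) (u n).
Proof.
move=> next.
pose goodl l := forall i, (i < size l)%N -> Q i (nth t0 l i).
have /choice[g gP] : forall l, exists x, goodl l -> Q (size l) x /\ R l x.
  by move=> l; have [/next[x Px]|ng] := pselect (goodl l); [exists x|exists t0].
pose L n := iter n (fun l => rcons l (g l)) [::].
have LE n : L n = mkseq (g \o L) n by elim: n => // n IHn; rewrite mkseqS -IHn.
have goodL n : goodl (L n).
  elim: n => // n IHn i; rewrite /L iterS -/(L n) size_rcons ltnS leq_eqVlt nth_rcons.
  case: ltngtP => //= [lt_in _|-> _]; first exact: IHn.
  by have [] := gP _ IHn.
exists (g \o L) => n; rewrite -LE.
by have := gP _ (goodL n); rewrite {1}LE size_mkseq.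
Qed.

Definition zspan (G : zmodType) (l : seq G) (x : G) : Prop :=
  exists c : nat -> int, x = \sum_(i < size l) l`_i *~ c i.

Lemma zspan_mkseq (G : zmodType) (u : nat -> G) n x :
  zspan (mkseq u n) x <-> exists c : nat -> int, x = \sum_(i < n) u i *~ c i.
Proof.
rewrite /zspan size_mkseq; split=> [][c ->]; exists c; apply: eq_bigr => i _;
  by rewrite nth_mkseq.
Qed.

Lemma subgrp_zspan (G : zmodType) (l : seq G) : subgrp (zspan l).
Proof.
split; first by exists (fun=> 0); rewrite big1 // => i _; rewrite mulr0z.
move=> _ _ [c ->] [d ->]; exists (fun i => c i - d i).
by rewrite -sumrB; apply: eq_bigr => i _; rewrite mulrzBr.
Qed.

(** Independence means that the sum of the cyclic groups generated by the terms
    and of [W] is direct; terms of finite order are allowed. *)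
Definition independent_mod (G : zmodType) (W : G -> Prop) (u : nat -> G) :=
  forall n (q : nat -> int), W (\sum_(i < n) u i *~ q i) ->
    forall i, (i < n)%N -> u i *~ q i = 0.

Definition independent (G : zmodType) := @independent_mod G (fun x => x = 0).

Lemma independent_stepwise (G : zmodType) (W : G -> Prop) (u : nat -> G) :
  (forall n (c : int) y, zspan (mkseq u n) y -> W (u n *~ c + y) -> u n *~ c = 0) ->
  independent_mod W u.
Proof.
move=> step; elim=> [//|n IHn] q; rewrite big_ord_recr /= addrC => Wsum.
have un0 : u n *~ q n = 0.
  by apply: step Wsum; apply/zspan_mkseq; exists q.
move=> i; rewrite ltnS leq_eqVlt => /predU1P[-> //|]; apply: IHn.
by rewrite -[X in W X]add0r -{1}un0.
Qed.

Section IntegerCombinations.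
Variables (G : zmodType) (u : nat -> G).

Definition zcomb (q : {poly int}) : G := \sum_(i < size q) u i *~ q`_i.

Lemma zcomb_widen n (q : {poly int}) : (size q <= n)%N -> zcomb q = \sum_(i < n) u i *~ q`_i.
Proof.
move=> le_qn; rewrite /zcomb (big_ord_widen _ (fun i => u i *~ q`_i) le_qn) big_mkcond.
apply: eq_bigr => i _; case: ltnP => // le_qi.
by rewrite nth_default ?mulr0z.
Qed.

Lemma zcomb_is_zmod_morphism : {morph zcomb : p q / p - q}.
Proof.
move=> p q; pose n := maxn (size p) (size q).
have le_n : (size (p - q)%R <= n)%N.
  by rewrite (leq_trans (size_polyD _ _)) // size_polyN.
rewrite !(@zcomb_widen n) ?leq_maxl ?leq_maxr // -sumrB.
by apply: eq_bigr => i _; rewrite coefB mulrzBr.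
Qed.

HB.instance Definition _ :=
  GRing.isZmodMorphism.Build {poly int} G zcomb zcomb_is_zmod_morphism.

Lemma zcombXn n : zcomb 'X^n = u n.
Proof.
rewrite (@zcomb_widen n.+1) ?size_polyXn // big_ord_recr /= coefXn eqxx mulr1z.
rewrite big1 ?add0r // => i _; rewrite coefXn.
by rewrite ltn_eqF ?mulr0z.
Qed.

Lemma zcomb_eq0 (q : {poly int}) : (forall i, u i *~ q`_i = 0) -> zcomb q = 0.
Proof. by move=> q0; rewrite /zcomb big1. Qed.

Lemma independent_zcomb_mod (W : G -> Prop) (q : {poly int}) :
  independent_mod W u -> W (zcomb q) -> forall i, u i *~ q`_i = 0.
Proof.
move=> ind_u Wq i; have [lt_iq|le_qi] := ltnP i (size q).
  exact: (ind_u (size q)).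
by rewrite nth_default ?mulr0z.
Qed.

End IntegerCombinations.

(** Nonzero elements of a cyclic group are not divisible by all integers in it:
    take a multiple of the order of [g] if it is finite, and a number larger
    than [c] otherwise. *)
Lemma cyclic_reduced (G : zmodType) (g : G) (c : int) :
  (forall m, (0 < m)%N -> exists k : int, g *~ c = g *~ (k * m%:Z)) -> g *~ c = 0.
Proof.
move=> div_c; have [[c0 [nz_c0 gc0]]|inf_g] :=
  pselect (exists c0 : int, c0 != 0 /\ g *~ c0 = 0).
  have [|k ->] := div_c `|c0|%N; first by rewrite absz_gt0.
  rewrite mulrC mulrzA; suff -> : g *~ `|c0|%N%:Z = 0 by rewrite mul0rz.
  by rewrite -pmulrn; apply: (@subgrp_absz _ _ (@subgrp_eq0 G)).
have [//|k gk] := div_c `|c|.+1%N.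
have [/eqP c_k|nz] := boolP (c - k * `|c|.+1%N%:Z == 0); last first.
  by case: inf_g; exists (c - k * `|c|.+1%N%:Z); rewrite mulrzBr gk subrr.
suff -> : c = 0 by rewrite mulr0z.
have def_c : c = k * `|c|.+1%N%:Z by apply/subr0_eq.
have : `|c|%N = (`|k| * `|c|.+1)%N by rewrite {1}def_c abszM.
have [->|] := posnP `|k|%N; [lia|nia].
Qed.

(** The sum of the cyclic groups [<u i>] embeds in [D] by [u i |-> w i] and maps
    onto it by [u i |-> v i]. Splitting the second map would embed the divisible
    group [D] in a direct sum of cyclic groups, whose components contain no
    nonzero element divisible by all integers. *)
Theorem no_divisible_quotient (H D : zmodType) (u : nat -> H) (v w : nat -> D) :
  generalized_Bassian H -> independent u -> divisible D -> independent w ->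
  (forall i c, u i *~ c = 0 <-> w i *~ c = 0) ->
  (forall i c, u i *~ c = 0 -> v i *~ c = 0) ->
  (forall d, exists i, v i = d) ->
  forall d : D, d = 0.
Proof.
move=> gB ind_u divD ind_w uw uv v_surj.
have u0 q : zcomb u q = 0 -> forall i, u i *~ q`_i = 0.
  by move=> q0; apply: (independent_zcomb_mod ind_u).
have [s sE] := divisible_extension (e := zcomb u) (g := zcomb v) divD
  (fun q q0 => zcomb_eq0 (fun i => uv i _ (u0 q q0 i))).
have [j jE] := divisible_extension (e := zcomb u) (g := zcomb w) divD
  (fun q q0 => zcomb_eq0 (fun i => (uw i _).1 (u0 q q0 i))).
pose F x := exists q, x = zcomb u q.
have s_onto d : exists2 f, F f & s f = d.
  by have [i <-] := v_surj d; exists (zcomb u 'X^i); [exists 'X^i|rewrite sE; apply: zcombXn].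
have inj_j f : F f -> j f = 0 -> f = 0.
  case=> q ->; rewrite jE => q0; apply: zcomb_eq0 => i; apply/uw.
  exact: (independent_zcomb_mod ind_w).
have [K [sK K0 decK]] := generalized_Bassian_split gB (subgrp_range (zcomb u))
  (fun h => s_onto (s h)) (fun h => s_onto (j h)) inj_j.
have lift d : exists y, [/\ F y, K y & s y = d].
  have [f Ff <-] := s_onto d; exact: decK.
move=> d; have [y [[q def_y] Ky <-]] := lift d.
suff -> : y = 0 by rewrite raddf0.
rewrite def_y; apply: zcomb_eq0 => i; apply: cyclic_reduced => m m_gt0.
have [d' def_d'] := divD m (s y) m_gt0.
have [y' [[q' def_y'] Ky' sy']] := lift d'.
have : y - y' *+ m = 0.
  apply: K0; last by apply: subgrpB => //; apply: subgrpMn.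
    by exists (q - q' *+ m); rewrite def_y def_y' -raddfMn -raddfB.
  by rewrite raddfB raddfMn /= sy' def_d' subrr.
rewrite def_y def_y' -raddfMn -raddfB => /u0 /(_ i) /eqP.
rewrite coefB coefMn mulrzBr subr_eq0 => /eqP ->; exists q'`_i.
by rewrite -mulr_natr natz.
Qed.

(** * Torsion-free rank *)

Definition finite_pred (T : choiceType) (P : T -> Prop) : Prop :=
  exists s : seq T, forall x, P x -> x \in s.

Lemma finite_predS (T : choiceType) (P Q : T -> Prop) :
  (forall x, P x -> Q x) -> finite_pred Q -> finite_pred P.
Proof. by move=> PQ [s sP]; exists s => x /PQ/sP. Qed.

Lemma finite_pred_img (T U : choiceType) (f : T -> U) (P : T -> Prop) :
  finite_pred P -> finite_pred (fun y => exists2 x, P x & y = f x).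
Proof. by move=> [s sP]; exists (map f s) => _ [x /sP sx ->]; apply: map_f. Qed.

Lemma finite_predD (G : zmodType) (P Q : G -> Prop) :
  finite_pred P -> finite_pred Q ->
  finite_pred (fun x => exists y z, [/\ P y, Q z & x = y + z]).
Proof.
move=> [s sP] [t tQ]; exists [seq y + z | y <- s, z <- t].
by move=> _ [y [z [/sP sy /tQ tz ->]]]; apply: allpairs_f.
Qed.

Lemma infinite_fresh (T : choiceType) (P Q : T -> Prop) :
  ~ finite_pred P -> finite_pred Q -> exists2 x, P x & ~ Q x.
Proof.
move=> infP finQ; have [//|noPQ] := pselect (exists2 x, P x & ~ Q x).
case: infP; apply: finite_predS finQ => x Px.
by have [//|nQx] := pselect (Q x); case: noPQ; exists x.
Qed.

Lemma finite_pred_ker (G H : zmodType) (f : {additive G -> H}) (P : G -> Prop) :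
  subgrp P -> finite_pred (fun y => exists2 x, P x & y = f x) ->
  finite_pred (fun x => P x /\ f x = 0) -> finite_pred P.
Proof.
move=> sP [s sfP] [t tker].
have /choice[r rP] : forall y, exists x, (exists2 x', P x' & y = f x') -> P x /\ f x = y.
  move=> y; have [[x Px ->]|no] := pselect (exists2 x', P x' & y = f x').
    by exists x.
  by exists 0.
exists [seq r y + z | y <- s, z <- t] => x Px.
have imx : exists2 x', P x' & f x = f x' by exists x.
have [Pr fr] := rP _ imx; rewrite -[x](subrK (r (f x))) addrC.
apply: allpairs_f; first exact: sfP.
by apply: tker; rewrite raddfB fr subrr; split=> //; apply: subgrpB.
Qed.

Lemma finite_zspan (G : zmodType) (l : seq G) :
  (forall x, x \in l -> exists2 m, (0 < m)%N & x *+ m = 0) ->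
  finite_pred (zspan l).
Proof.
elim: l => [|x l IHl] tor.
  by exists [:: 0] => _ [c ->]; rewrite big_ord0 mem_seq1.
have [|m m_gt0 xm0] := tor x; first exact: mem_head.
have finx : finite_pred (fun y => exists c : int, y = x *~ c).
  exists [seq x *+ k | k <- iota 0 m] => _ [c ->].
  have m_neq0 : (m%:Z != 0)%R by rewrite -lt0n.
  rewrite (intdiv.divz_eq c m) mulrzDr mulrC mulrzA.
  rewrite -(pmulrn x m) xm0 mul0rz add0r.
  have := intdiv.ltz_pmod c (_ : 0 < m%:Z); have := intdiv.modz_ge0 c m_neq0.
  case: (c %% m)%Z => // k _ /(_ m_gt0) lt_km.
  by rewrite -pmulrn; apply: map_f; rewrite mem_iota.
have finl : finite_pred (zspan l).
  by apply: IHl => y ly; apply: tor; rewrite inE ly orbT.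
apply: finite_predS (finite_predD finx finl) => _ [c ->].
exists (x *~ c 0%N), (\sum_(i < size l) l`_i *~ c i.+1); split.
- by exists (c 0%N).
- by exists (fun i => c i.+1).
- by rewrite big_ord_recl.
Qed.

(** A bound on the size of independent families, rather than a finite maximal
    one, so as to pass to subgroups. *)
Definition finite_rank (G : zmodType) : Prop :=
  exists n, forall x : nat -> G, exists c : nat -> int,
    (exists2 i, (i < n)%N & c i != 0) /\ \sum_(i < n) x i *~ c i = 0.

Lemma finite_rank_commensurable (A H H' : zmodType) (e : {additive A -> H'})
    (i : {additive H -> H'}) :
  injective i ->
  (forall h, exists2 m : int, m != 0 & exists a, i h *~ m = e a) ->
  finite_rank A -> finite_rank H.
Proof.
move=> inj_i com [n nP]; exists n => x.
have /choice[m mP] : forall k, exists m : int, m != 0 /\ exists a, i (x k) *~ m = e a.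
  by move=> k; have [m] := com (x k); exists m.
have /choice[a aP] k : exists a, i (x k) *~ m k = e a by case: (mP k).
have [c [[k lt_kn nz_ck] sum0]] := nP a.
exists (fun k => m k * c k); split.
  by exists k => //; rewrite mulf_neq0 //; case: (mP k).
apply: inj_i; rewrite raddf0; transitivity (e 0); last exact: raddf0.
rewrite -sum0 !raddf_sum /=; apply: eq_bigr => j _.
by rewrite !raddfMz /= -aP mulrzA.
Qed.

Lemma finite_rank_embeds (G H : zmodType) :
  embeds G H -> finite_rank H -> finite_rank G.
Proof.
move=> [f inj_f]; apply: (@finite_rank_commensurable H G H idfun f inj_f) => h.
by exists 1 => //; exists (f h).
Qed.

Lemma finite_rank_basis (G : zmodType) : finite_rank G ->
  exists k (x : nat -> G),
    (forall c : nat -> int, \sum_(i < k) x i *~ c i = 0 ->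
       forall i, (i < k)%N -> c i = 0) /\
    forall y : nat -> G, exists c : nat -> int,
      (exists2 i, (i < k.+1)%N & c i != 0) /\ \sum_(i < k.+1) y i *~ c i = 0.
Proof.
move=> [n0 n0P].
pose dep n := `[< forall x : nat -> G, exists c : nat -> int,
    (exists2 i, (i < n)%N & c i != 0) /\ \sum_(i < n) x i *~ c i = 0 >].
have ex_n : exists n, dep n by exists n0; apply/asboolP.
case: (ex_minnP ex_n) => -[|k] /asboolP kP kmin.
  by have [c [[i]]] := kP (fun=> 0).
have /asboolPn/existsNP[x xP] : ~~ dep k by apply/negP => /kmin; rewrite ltnn.
exists k, x; split=> // c sum0 i lt_ik; apply/eqP/negPn/negP => nz_ci.
by apply: xP; exists c; split=> //; exists i.
Qed.

Lemma finite_rank_zspan (G : zmodType) : finite_rank G ->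
  exists l : seq G, forall y, exists2 c : int, c != 0 & zspan l (y *~ c).
Proof.
move=> /finite_rank_basis[k [x [free_x dep]]]; exists (mkseq x k) => y.
have [c [[i lt_ik nz_ci] sum0]] := dep (fun i => if (i < k)%N then x i else y).
move: sum0; rewrite big_ord_recr /= ltnn.
under eq_bigr => j _ do rewrite ltn_ord.
move=> sum0; exists (c k).
  apply: contra_neq nz_ci => ck0; move: sum0; rewrite ck0 mulr0z addr0 => sum0.
  by move: lt_ik; rewrite ltnS leq_eqVlt => /predU1P[-> //|]; apply: free_x.
apply/zspan_mkseq; exists (fun i => - c i).
move: sum0 => /eqP; rewrite addrC addr_eq0 => /eqP ->.
by rewrite -sumrN; apply: eq_bigr => j _; rewrite mulrNz.
Qed.

Lemma common_denominator (s : seq rat) :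
  exists2 M : nat, (0 < M)%N & forall x, x \in s -> exists z : int, x * M%:R = z%:~R.
Proof.
elim: s => [|x s [M M_gt0 MP]]; first by exists 1%N.
have def_D : `|denq x|%N%:R = (denq x)%:~R :> rat by rewrite pmulrn absz_denq.
exists (`|denq x| * M)%N; first by rewrite muln_gt0 M_gt0 absz_gt0 denq_neq0.
move=> y; rewrite natrM inE def_D => /predU1P[->|/MP[z yM]].
  exists (numq x * M%:Z); rewrite rmorphM /= -pmulrn mulrA; congr (_ * _).
  by rewrite -{1}[x]divq_num_den divfK // intr_eq0 denq_neq0.
by exists (denq x * z); rewrite mulrCA yM rmorphM.
Qed.

(** Up to nonzero factors the given elements are integral combinations of [l];
    being more than [size l], their coefficient matrix has a rational relation
    between its rows, from which denominators are cleared. *)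
Lemma zspan_finite_rank (G : zmodType) (l : seq G) :
  (forall y, exists2 c : int, c != 0 & zspan l (y *~ c)) -> finite_rank G.
Proof.
move=> spanl; exists (size l).+1 => x.
have /choice[c cP] : forall k, exists c : int, c != 0 /\ zspan l (x k *~ c).
  by move=> k; have [c] := spanl (x k); exists c.
have /choice[a aP] k : exists a : nat -> int,
    x k *~ c k = \sum_(j < size l) l`_j *~ a j by case: (cP k).
pose A : 'M[rat]_((size l).+1, size l) := \matrix_(i, j) (a i j)%:~R.
have nz_v : nz_row (kermx A) != 0.
  rewrite nz_row_eq0 -mxrank_eq0 mxrank_ker subn_eq0 -ltnNge ltnS.
  exact: rank_leq_col.
have vA : nz_row (kermx A) *m A = 0 by apply/sub_kermxP/nz_row_sub.
set v := nz_row _ in nz_v vA.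
have [M M_gt0 MP] := common_denominator [seq v 0 i | i <- enum 'I_(size l).+1].
have /choice[z zP] : forall i, exists z : int, v 0 i * M%:R = z%:~R.
  by move=> i; apply: MP; apply: map_f; rewrite mem_enum.
have nz_M : M%:R != 0 :> rat by rewrite pnatr_eq0 -lt0n.
exists (fun i => c i * z (inord i)); split.
  have /rV0Pn[i nz_vi] := nz_v.
  exists i => //; rewrite inord_val mulf_neq0 //; first by case: (cP i).
  by rewrite -(intr_eq0 rat) -zP mulf_neq0.
under eq_bigr => i _ do rewrite inord_val mulrzA aP.
transitivity (\sum_(j < size l) l`_j *~ \sum_(i < (size l).+1) (a i j * z i)).
  under eq_bigr => i _ do rewrite mulrz_suml.
  rewrite exchange_big; apply: eq_bigr => j _; rewrite mulrz_sumr.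
  by apply: eq_bigr => i _; rewrite mulrzA.
rewrite big1 // => j _; suff -> : \sum_(i < (size l).+1) (a i j * z i) = 0.
  by rewrite mulr0z.
apply/eqP; rewrite -(intr_eq0 rat) rmorph_sum /=.
have /rowP/(_ j) := vA; rewrite !mxE => sum0.
apply/eqP; transitivity ((\sum_i v 0 i * A i j) * M%:R); last by rewrite sum0 mul0r.
rewrite mulr_suml; apply: eq_bigr => i _.
by rewrite mulrAC zP mxE mulrC -intrM mulrC.
Qed.

(** An independent family of maximal size [k] stays independent in the quotient,
    hence lifts to a family independent modulo the kernel; together with a
    non-torsion kernel element this would be [k + 1] independent elements. *)
Lemma finite_rank_torsion_kernel (G Q : zmodType) (pi f : {additive G -> Q}) :
  finite_rank G -> (forall y, exists x, pi x = y) -> injective f ->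
  forall z, pi z = 0 -> exists2 m, (0 < m)%N & z *+ m = 0.
Proof.
move=> /finite_rank_basis[k [x [free_x dep]]] pi_surj inj_f z piz.
have /choice[y yP] i : exists y, pi y = f (x i) by apply: pi_surj.
have [c [[i lt_ik nz_ci] sum0]] := dep (fun i => if (i < k)%N then y i else z).
move: sum0; rewrite big_ord_recr /= ltnn.
under eq_bigr => j _ do rewrite ltn_ord.
move=> sum0.
have c0 : forall i, (i < k)%N -> c i = 0.
  apply: free_x; apply: inj_f; rewrite raddf0 raddf_sum.
  have := congr1 pi sum0; rewrite raddf0 raddfD /= raddfMz /= piz mul0rz addr0.
  rewrite raddf_sum; apply: etrans; apply: eq_bigr => j _.
  by rewrite !raddfMz /= yP.
have nz_ck : c k != 0.
  by move: lt_ik nz_ci; rewrite ltnS leq_eqVlt => /predU1P[-> //|/c0 ->].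
exists `|c k|%N; first by rewrite absz_gt0.
apply: (@subgrp_absz _ _ (@subgrp_eq0 G)); move: sum0.
by rewrite big1 ?add0r // => j _; rewrite c0 ?mulr0z.
Qed.

Lemma coef_sumXn (a : nat -> rat) (q : nat -> int) n i : (i < n)%N ->
  (\sum_(j < n) (a j *: 'X^j : {poly rat}) *~ q j)`_i = a i *~ q i.
Proof.
move=> lt_in; rewrite coef_sum (bigD1 (Ordinal lt_in)) //= big1 ?addr0.
  by rewrite -[_`_i]/(coefp i _) raddfMz /= coefZ coefXn eqxx mulr1.
move=> j; rewrite -val_eqE /= -[_`_i]/(coefp i _) raddfMz /= coefZ coefXn eq_sym.
by move/negPf ->; rewrite mulr0 mul0rz.
Qed.

(** For infinite rank there is an independent sequence of elements of infinite
    order; the free group on it maps onto the countable divisible group of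
    rational polynomials, and embeds in it. *)
Theorem generalized_Bassian_finite_rank (H : zmodType) :
  generalized_Bassian H -> finite_rank H.
Proof.
move=> gB; have [//|inf_rank] := pselect (finite_rank H).
have next l : exists x : H, forall c : int, zspan l (x *~ c) -> c = 0.
  have [//|no] := pselect (exists x : H, forall c : int, zspan l (x *~ c) -> c = 0).
  case: inf_rank; apply: (@zspan_finite_rank _ l) => y.
  have [//|noc] := pselect (exists2 c : int, c != 0 & zspan l (y *~ c)).
  case: no; exists y => c spanc; apply/eqP/negPn/negP => nz_c.
  by apply: noc; exists c.
have [u uP] := @sequence_choice H 0 (fun _ _ => True)
  (fun l x => forall c : int, zspan l (x *~ c) -> c = 0)
  (fun l _ => let: ex_intro x Px := next l in ex_intro _ x (conj I Px)).
have u_inf n (c : int) : u n *~ c = 0 -> c = 0.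
  by move=> uc0; have [_] := uP n; apply; rewrite uc0; apply: subgrp0; apply: subgrp_zspan.
have Xcoef (q : nat -> int) n i : (i < n)%N ->
    (\sum_(j < n) ('X^j : {poly rat}) *~ q j)`_i = (q i)%:~R.
  move=> lt_in; rewrite -(coef_sumXn (fun=> 1) q lt_in).
  by under [in RHS]eq_bigr => j _ do rewrite scale1r.
suff : (1 : {poly rat}) = 0 by move/eqP; rewrite oner_eq0.
apply: (@no_divisible_quotient H {poly rat} u (fun i => odflt 0 (unpickle i))
          (fun i => 'X^i) gB).
- apply: independent_stepwise => n c y span_y /eqP; rewrite addr_eq0 => /eqP uc.
  have [_ /(_ c) ->] := uP n; first by rewrite mulr0z.
  by rewrite uc; apply: subgrpN => //; apply: subgrp_zspan.
- move=> n x n_gt0; exists (n%:R^-1 *: x); rewrite -scaler_nat scalerA.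
  by rewrite mulfV ?scale1r // pnatr_eq0 -lt0n.
- move=> n q sum0 i lt_in; have := Xcoef q n i lt_in; rewrite sum0 coef0.
  by move/esym/eqP; rewrite intr_eq0 => /eqP ->; rewrite mulr0z.
- move=> i c; split=> [/u_inf ->|]; first by rewrite mulr0z.
  move=> /(congr1 (coefp i)); rewrite raddfMz /= coefXn eqxx coef0 => /eqP.
  by rewrite intr_eq0 => /eqP ->; rewrite mulr0z.
- by move=> i c /u_inf ->; rewrite mulr0z.
- by move=> d; exists (pickle d); rewrite pickleK.
Qed.

(** * Primary components *)

Lemma ex_muln (G : zmodType) n : exists f : {additive G -> G}, forall x, f x = x *+ n.
Proof. by have [f fE] := ex_additive (fun x y : G => mulrnBl n x y); exists f. Qed.

Lemma subgrp_primary (G : zmodType) p : subgrp (@primary_component G p).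
Proof.
split; first by exists 0%N; rewrite mul0rn.
move=> x y [a xa] [b yb]; exists (a + b)%N.
by rewrite expnD mulrnBl mulrnA xa mul0rn mulnC mulrnA yb mul0rn subrr.
Qed.

Lemma primary_muln (G : zmodType) p k (x : G) :
  primary_component p (x *+ p ^ k) -> primary_component p x.
Proof. by case=> j xj; exists (k + j)%N; rewrite expnD mulrnA. Qed.

Lemma subgrp_coprime_div (G : zmodType) (V : G -> Prop) (f : G) a q :
  subgrp V -> V f -> f *+ a = 0 -> coprime a q -> exists2 f', V f' & f = f' *+ q.
Proof.
move=> sV Vf fa0 co_aq.
have sqV : subgrp (fun x => exists2 y, V y & x = y *+ q).
  split; first by exists 0; rewrite ?mul0rn //; apply: subgrp0.
  move=> _ _ [y Vy ->] [z Vz ->]; exists (y - z); first exact: subgrpB.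
  by rewrite mulrnBl.
apply: (subgrp_coprime sqV co_aq); last by exists f.
by rewrite fa0; apply: (subgrp0 sqV).
Qed.

Lemma socle_neq0 (G : zmodType) p k (x : G) :
  x != 0 -> x *+ p ^ k = 0 -> exists j, x *+ p ^ j != 0 /\ x *+ p ^ j *+ p = 0.
Proof.
move=> nz_x; elim: k => [|k IHk] xk; first by rewrite mulr1n in xk; rewrite xk eqxx in nz_x.
have [/IHk //|nz] := eqVneq (x *+ p ^ k) 0.
by exists k; split=> //; rewrite -mulrnA -expnSr.
Qed.

(** [V] is a direct sum of copies of the integers modulo [p ^ k.+1], hence
    injective among the groups killed by [p ^ k.+1], such as the quotient
    of [S] by [U]. *)
Lemma homogeneous_complement (G : zmodType) (S U V : G -> Prop) p k :
  prime p -> subgrp S -> subgrp U -> subgrp V ->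
  (forall x, U x -> S x) -> (forall x, V x -> S x) ->
  (forall x, U x -> V x -> x = 0) -> (forall x, S x -> U (x *+ p ^ k.+1)) ->
  (forall f, V f -> f *+ p ^ k.+1 = 0) ->
  (forall f, V f -> f *+ p ^ k = 0 -> exists2 f', V f' & f = f' *+ p) ->
  exists M : G -> Prop,
    [/\ subgrp M, forall x, U x -> M x, forall x, M x -> S x,
        forall x, M x -> V x -> x = 0
      & forall h, S h -> exists f m, [/\ V f, M m & h = f + m]].
Proof.
move=> pr_p sS sU sV US VS UV0 pSU V0 divV; apply: complement => //.
move=> M sM UM MV0 q h m f pr_q Sh Mm Vf def_qh.
have [def_q|ne_qp] := eqVneq q p; last first.
  apply: (subgrp_coprime_div sV Vf (V0 f Vf)).
  by rewrite coprimeXl // prime_coprime // dvdn_prime2 // eq_sym.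
rewrite def_q in def_qh *; apply: divV => //; apply: MV0; last exact: subgrpMn.
have : M ((m + f) *+ p ^ k) by rewrite -def_qh -mulrnA -expnS; apply/UM/pSU.
by rewrite mulrnDl; apply: (subgrp_addKr sM); apply: subgrpMn.
Qed.

Section PrimePowerOrder.
Variables (G : zmodType) (p n : nat) (u : G).
Hypotheses (pr_p : prime p) (un1 : u *+ p ^ n.+1 = 0).

Lemma mulrz_dvd_eq0 (c : int) : (p ^ n.+1 %| `|c|)%N -> u *~ c = 0.
Proof.
move=> p_c; have /intdiv.dvdzP[k ->] : ((p ^ n.+1)%N%:Z %| c)%Z by [].
by rewrite mulrC mulrzA -pmulrn un1 mul0rz.
Qed.

Lemma subgrp_mulrz_pfactor (P : G -> Prop) (c : int) :
  subgrp P -> P (u *~ c) -> ~~ (p ^ n.+1 %| `|c|)%N -> P (u *+ p ^ n).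
Proof.
move=> sP /(subgrp_absz sP) Pc ndvd_c.
have Pn : P (u *+ p ^ n.+1) by rewrite un1; apply: subgrp0.
have := subgrp_gcd sP Pc Pn.
have /(dvdn_pfactor _ _ pr_p)[v le_v def_v] := dvdn_gcdr `|c|%N (p ^ n.+1).
have le_vn : (v <= n)%N.
  rewrite -ltnS ltn_neqAle le_v andbT; apply: contraNneq ndvd_c => <-.
  by rewrite -def_v dvdn_gcdl.
by rewrite def_v -(subnKC le_vn) expnD mulrnA => Pv; apply: subgrpMn.
Qed.

Lemma mulrz_eq0_dvd (c : int) :
  u *+ p ^ n != 0 -> u *~ c = 0 -> (p ^ n.+1 %| `|c|)%N.
Proof.
move=> nz_un uc; apply: contraNT nz_un => ndvd_c.
by apply/eqP; apply: (subgrp_mulrz_pfactor (@subgrp_eq0 G) uc).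
Qed.

End PrimePowerOrder.

(** Independence of elements [u n] of order [p ^ (o n).+1] can be checked on
    their multiples of order [p]. *)
Lemma independent_socle (G : zmodType) (W : G -> Prop) (u : nat -> G) p (o : nat -> nat) :
  prime p -> subgrp W -> (forall n, u n *+ p ^ (o n).+1 = 0) ->
  (forall n y, zspan (mkseq u n) y -> ~ W (u n *+ p ^ o n + y)) ->
  independent_mod W u.
Proof.
move=> pr_p sW un1 fresh; apply: independent_stepwise => n c y span_y Wuy.
have [|ndvd_c] := boolP (p ^ (o n).+1 %| `|c|)%N.
  exact: mulrz_dvd_eq0.
have sP := subgrpS sW (subgrp_zspan (mkseq u n)).
have Puc : exists w z, [/\ W w, zspan (mkseq u n) z & u n *~ c = w + z].
  by exists (u n *~ c + y), (- y); rewrite addrK; split=> //;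
    apply: subgrpN => //; apply: subgrp_zspan.
have [w [z [Ww span_z uz]]] := subgrp_mulrz_pfactor pr_p (un1 n) sP Puc ndvd_c.
case: (fresh n (- z)); last by rewrite uz addrK.
by apply: subgrpN => //; apply: subgrp_zspan.
Qed.

(** The intersection of [G[p]] with [p ^ k G]. *)
Definition socle (G : zmodType) p k (x : G) : Prop :=
  x *+ p = 0 /\ exists y, x = y *+ p ^ k.

Lemma subgrp_socle (G : zmodType) p k : subgrp (@socle G p k).
Proof.
split; first by split; [rewrite mul0rn | exists 0; rewrite mul0rn].
move=> x y [xp [x' def_x]] [yp [y' def_y]]; split; first by rewrite mulrnBl xp yp subrr.
by exists (x' - y'); rewrite mulrnBl def_x def_y.
Qed.

Lemma socleS (G : zmodType) p j k (x : G) : (j <= k)%N -> socle p k x -> socle p j x.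
Proof.
move=> le_jk [xp [y def_x]]; split=> //; exists (y *+ p ^ (k - j)).
by rewrite -mulrnA -expnD subnK.
Qed.

Lemma socle_lift (G : zmodType) p k (Q : G -> Prop) :
  ~ finite_pred (@socle G p k) -> finite_pred Q ->
  exists y : G, y *+ p ^ k.+1 = 0 /\ ~ Q (y *+ p ^ k).
Proof.
move=> inf_k finQ; have [x [xp [y def_x]] nQ] := infinite_fresh inf_k finQ.
by exists y; rewrite expnSr mulrnA -def_x.
Qed.

Lemma finite_zspan_primary (G : zmodType) p (o : nat -> nat) (l : seq G) :
  prime p -> (forall i, (i < size l)%N -> l`_i *+ p ^ o i = 0) ->
  finite_pred (zspan l).
Proof.
move=> pr_p l0; apply: finite_zspan => x /(nthP 0)[i lt_il <-].
by exists (p ^ o i)%N; [rewrite expn_gt0 prime_gt0 | apply: l0].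
Qed.

(** * Infinite socles in generalized Bassian groups *)

(** The polynomials over the localization of the integers at [p]. *)
Definition local_integral (p : nat) (q : {poly rat}) : Prop :=
  exists2 m : nat, coprime p m & forall i, exists z : int, q`_i * m%:R = z%:~R.

Lemma subgrp_local_integral p : subgrp (local_integral p).
Proof.
split; first by exists 1%N => [|i]; [rewrite coprimen1 | exists 0; rewrite coef0 mul0r].
move=> a b [m co_m am] [n co_n bn]; exists (m * n)%N => [|i].
  by rewrite coprimeMr co_m.
have [[z az] [z' bz]] := (am i, bn i); exists (z * n%:Z - z' * m%:Z).
rewrite coefB mulrBl natrM mulrA az [b`_i * _]mulrCA bz rmorphB !rmorphM /=.
by rewrite -!pmulrn [m%:R * _]mulrC.
Qed.

Lemma local_integralXn p i : local_integral p 'X^i.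
Proof.
exists 1%N => [|j]; first by rewrite coprimen1.
by exists (j == i)%:Z; rewrite coefXn mulr1 -pmulrn.
Qed.

Lemma not_local_integral_pV p i :
  prime p -> ~ local_integral p (p%:R^-1 *: 'X^i).
Proof.
move=> pr_p [m co_pm /(_ i)[z]]; rewrite coefZ coefXn eqxx mulr1.
have nz_p : p%:R != 0 :> rat by rewrite pnatr_eq0 -lt0n prime_gt0.
move=> /(canRL (mulVKf nz_p)) def_m.
have : m%:Z = p%:Z * z.
  by apply: (@intr_inj rat); rewrite rmorphM /= -!pmulrn.
move=> /(congr1 absz); rewrite abszM /= => def_m'.
by move: co_pm; rewrite def_m' prime_coprime // dvdn_mulr.
Qed.

Lemma local_integral_bounded p (q : {poly rat}) :
  prime p -> exists n, local_integral p (q *+ p ^ n).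
Proof.
move=> pr_p; have [M M_gt0 MP] := common_denominator q.
have [m co_pm def_M] := pfactor_coprime pr_p M_gt0.
exists (logn p M), m => // i; rewrite coefMn.
have [lt_iq|le_qi] := ltnP i (size q); last first.
  by exists 0; rewrite nth_default // mul0rn mul0r.
have [z qz] := MP _ (mem_nth 0 lt_iq); exists z.
by rewrite -qz mulrnAl -mulr_natr {2}def_M natrM mulrA.
Qed.

(** If all these sets were infinite, direct sums of cyclic [p]-groups of any
    prescribed orders would embed in [H], and the orders can be chosen for such a
    sum to map onto the countable divisible [p]-group of rational polynomials
    modulo [p]-integral ones, in which it also embeds. *)
Lemma generalized_Bassian_socle (H : zmodType) p :
  generalized_Bassian H -> prime p -> exists k, finite_pred (@socle H p k).
Proof.
move=> gB pr_p; have [//|no_k] := pselect (exists k, finite_pred (@socle H p k)).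
have inf_k k : ~ finite_pred (@socle H p k) by move=> fin_k; apply: no_k; exists k.
have [D [pi [pi_surj pi0]]] := quotient (subgrp_local_integral p).
pose q i : {poly rat} := odflt 0 (unpickle i).
have /choice[o oP] : forall i, exists n, pi (q i) *+ p ^ n = 0.
  move=> i; have [n nP] := local_integral_bounded (q i) pr_p.
  by exists n; rewrite -raddfMn; apply/pi0.
have [l lP|u uP] := @sequence_choice H 0 (fun i x => x *+ p ^ (o i).+1 = 0)
  (fun l x => ~ zspan l (x *+ p ^ o (size l))).
  apply: socle_lift => //.
  exact: (finite_zspan_primary pr_p (o := fun i => (o i).+1)).
have un1 n : u n *+ p ^ (o n).+1 = 0 by have [] := uP n.
have fresh n : ~ zspan (mkseq u n) (u n *+ p ^ o n).
  by have [_] := uP n; rewrite size_mkseq.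
have nz_un n : u n *+ p ^ o n != 0.
  by apply/eqP => un0; apply: (fresh n); rewrite un0; apply: (subgrp0 (subgrp_zspan _)).
have nz_p j : (p ^ j)%:R != 0 :> rat by rewrite pnatr_eq0 -lt0n expn_gt0 prime_gt0.
pose a i : rat := (p ^ (o i).+1)%:R^-1.
pose w i := pi (a i *: 'X^i).
have wn1 n : w n *+ p ^ (o n).+1 = 0.
  rewrite -raddfMn; apply/pi0; rewrite -scaler_nat scalerA mulfV // scale1r.
  exact: local_integralXn.
have nz_wn n : w n *+ p ^ o n != 0.
  apply/eqP; rewrite -raddfMn => /pi0; rewrite -scaler_nat scalerA /a.
  by rewrite expnSr natrM invfM mulrA mulfV // mul1r; apply: not_local_integral_pV.
have divD : divisible D.
  move=> n x n_gt0; have [y <-] := pi_surj x; exists (pi (n%:R^-1 *: y)).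
  by rewrite -raddfMn -scaler_nat scalerA mulfV ?scale1r // pnatr_eq0 -lt0n.
suff D0 : forall d : D, d = 0.
  have [] := @not_local_integral_pV p 0 pr_p.
  by apply/pi0/D0.
apply: (@no_divisible_quotient H D u (fun i => pi (q i)) w) => //.
- apply: (independent_socle pr_p (@subgrp_eq0 H) un1) => n y span_y /eqP.
  rewrite addr_eq0 => /eqP un; apply: (fresh n); rewrite un.
  by apply: subgrpN => //; apply: subgrp_zspan.
- move=> n c sum0 i lt_in; rewrite /w -raddfMz; apply/pi0.
  have /pi0[m co_m mP] : pi (\sum_(j < n) (a j *: 'X^j) *~ c j) = 0.
    by rewrite -[RHS]sum0 raddf_sum; apply: eq_bigr => j _; rewrite raddfMz.
  exists m => // j; have [z] := mP i; rewrite coef_sumXn // => def_z.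
  exists (if j == i then z else 0); rewrite -[_`_j]/(coefp j _) raddfMz /= coefZ coefXn.
  by case: eqP => _; rewrite ?mulr1 // mulr0 mul0rz mul0r.
- move=> i c; split=> [/(mulrz_eq0_dvd pr_p (un1 i) (nz_un i))|].
    exact: (mulrz_dvd_eq0 (wn1 i)).
  by move=> /(mulrz_eq0_dvd pr_p (wn1 i) (nz_wn i)); apply: (mulrz_dvd_eq0 (un1 i)).
- move=> i c /(mulrz_eq0_dvd pr_p (un1 i) (nz_un i)).
  by apply: mulrz_dvd_eq0; rewrite expnSr mulrnA oP mul0rn.
- by move=> d; have [y <-] := pi_surj d; exists (pickle y); rewrite /q pickleK.
Qed.

(** The retraction makes the range of [e] a direct summand, so that extension by
    zero on a complement is possible whatever [D] is. *)
Lemma retract_extension (C H D : zmodType) (e : {additive C -> H})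
    (g : {additive C -> D}) (rho : {additive H -> H}) :
  (forall h, exists c, rho h = e c) -> (forall c, rho (e c) = e c) ->
  (forall c, e c = 0 -> g c = 0) ->
  exists g' : {additive H -> D},
    (forall c, g' (e c) = g c) /\ forall h, exists c, g' h = g c.
Proof.
move=> /choice[c cP] rho_e ker_eg.
have g_uniq c1 c2 : e c1 = e c2 -> g c1 = g c2.
  by move=> e12; apply/subr0_eq; rewrite -raddfB; apply: ker_eg; rewrite raddfB e12 subrr.
have gB : {morph (fun h => g (c h)) : x y / x - y}.
  by move=> x y; rewrite -raddfB; apply: g_uniq; rewrite -cP !raddfB /= !cP.
have [g' g'E] := ex_additive gB; exists g'; split=> [c1|h]; rewrite g'E.
  by apply: g_uniq; rewrite -cP.
by exists (c h).
Qed.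

Lemma zcomb_shift (G : zmodType) (u : nat -> G) (q : {poly int}) :
  zcomb (fun i => u i.+1) q = zcomb u (q * 'X).
Proof.
have le_qX : (size (q * 'X)%R <= (size q).+1)%N.
  by rewrite (leq_trans (size_polyMleq _ _)) // size_polyX addn2.
rewrite (zcomb_widen _ le_qX) big_ord_recl coefMX mulr0z add0r.
by apply: eq_bigr => i _; rewrite coefMX.
Qed.

(** Were [socle p k] infinite, elements divisible by [p ^ k] but, even modulo each
    other, not by [p ^ k.+1] would make an infinite direct sum of copies of the
    integers modulo [p ^ k.+1], with generators [u i], a direct summand of [H].
    The shift [u i |-> u i.+1] embeds it in the image of the map [u 0 |-> p (u 0)]
    fixing the other generators, whose kernel, generated by [p ^ k (u 0)], is not
    a direct summand because [k > 0]. *)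
Lemma generalized_Bassian_socle_step (H : zmodType) p k :
  generalized_Bassian H -> prime p -> (0 < k)%N ->
  finite_pred (@socle H p k.+1) -> finite_pred (@socle H p k).
Proof.
move=> gB pr_p k_gt0 finW; have [//|inf_k] := pselect (finite_pred (@socle H p k)).
pose W := @socle H p k.+1; have sW : subgrp W := @subgrp_socle H p k.+1.
have [l lP|u uP] := @sequence_choice H 0 (fun _ x => x *+ p ^ k.+1 = 0)
  (fun l x => ~ exists y z, [/\ W y, zspan l z & x *+ p ^ k = y + z]).
  have finl := finite_zspan_primary pr_p (o := fun=> k.+1) lP.
  exact: (socle_lift inf_k (finite_predD finW finl)).
have un1 n : u n *+ p ^ k.+1 = 0 by have [] := uP n.
have fresh n : ~ exists y z, [/\ W y, zspan (mkseq u n) z & u n *+ p ^ k = y + z].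
  by have [] := uP n.
have nz_un n : u n *+ p ^ k != 0.
  apply/eqP => un0; apply: (fresh n); rewrite un0; exists 0, 0.
  by rewrite addr0; split=> //; [apply: subgrp0 sW | apply: (subgrp0 (subgrp_zspan _))].
have u_eq0 n c : u n *~ c = 0 <-> (p ^ k.+1 %| `|c|)%N.
  by split; [apply: mulrz_eq0_dvd | apply: mulrz_dvd_eq0].
have ind_uW : independent_mod W u.
  apply: (independent_socle pr_p sW un1) => n y span_y Wuy; apply: (fresh n).
  exists (u n *+ p ^ k + y), (- y); rewrite addrK; split=> //.
  by apply: subgrpN => //; apply: subgrp_zspan.
have u0 q : W (zcomb u q) -> forall i, u i *~ q`_i = 0.
  exact: independent_zcomb_mod.
have u00 q : zcomb u q = 0 -> forall i, u i *~ q`_i = 0.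
  by move=> q0; apply: u0; rewrite q0; apply: subgrp0 sW.
pose F x := exists q, x = zcomb u q.
have sF : subgrp F := subgrp_range (zcomb u).
have Fn1 f : F f -> f *+ p ^ k.+1 = 0.
  case=> q ->; rewrite -raddfMn; apply: zcomb_eq0 => i.
  by rewrite coefMn -mulr_natr natz mulrC mulrzA -pmulrn un1 mul0rz.
have FW0 f : F f -> W f -> f = 0.
  by case=> q -> Wq; apply: zcomb_eq0; apply: u0.
pose U x := exists h : H, x = h *+ p ^ k.+1.
have sU : subgrp U.
  split; first by exists 0; rewrite mul0rn.
  by move=> _ _ [x ->] [y ->]; exists (x - y); rewrite mulrnBl.
have UF0 x : U x -> F x -> x = 0.
  move=> [h def_x] Fx; apply/eqP/negPn/negP => nz_x.
  have [j [nz_xj xjp]] := socle_neq0 nz_x (Fn1 x Fx).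
  case/eqP: nz_xj; apply: FW0; first exact: subgrpMn.
  by split=> //; exists (h *+ p ^ j); rewrite def_x -!mulrnA mulnC.
have divF f : F f -> f *+ p ^ k = 0 -> exists2 f', F f' & f = f' *+ p.
  case=> q ->; rewrite -raddfMn => /u00 qn.
  have p_q i : (p%:Z %| q`_i)%Z.
    have /u_eq0 := qn i; rewrite coefMn -mulr_natr natz abszM expnS.
    by rewrite dvdn_pmul2r // expn_gt0 prime_gt0.
  exists (zcomb u (\poly_(i < size q) (q`_i %/ p)%Z)); first by eexists.
  rewrite -raddfMn; congr (zcomb u _); apply/polyP => i.
  rewrite coefMn coef_poly; case: ltnP => [_|le_qi]; last first.
    by rewrite nth_default // mul0rn.
  by rewrite -mulr_natr natz intdiv.divzK.
have [M [sM UM _ MF0 dec]] := homogeneous_complement pr_p (subgrp_all H) sU sF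
  (fun _ _ => I) (fun _ _ => I) UF0 (fun x _ => ex_intro _ x erefl) Fn1 divF.
have [rho [rhoF _ rho_id _]] := projection sF sM MF0 (fun h => dec h I).
have rho_e c : rho (zcomb u c) = zcomb u c by apply: rho_id; exists c.
pose a i : int := if i == 0%N then p%:Z else 1.
pose v i := u i *~ a i.
have [s [sE s_im]] := retract_extension (g := zcomb v) rhoF rho_e
  (fun q q0 => zcomb_eq0 (fun i => etrans (mulrzAC _ _ _)
     (etrans (congr1 (fun x => x *~ a i) (u00 q q0 i)) (mul0rz _ _)))).
have shift0 c : zcomb u c = 0 -> zcomb (fun i => u i.+1) c = 0.
  by move=> c0; apply: zcomb_eq0 => i; apply/u_eq0/(u_eq0 i)/u00.
have [j [jE j_im]] := retract_extension (g := zcomb (fun i => u i.+1)) rhoF rho_e shift0.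
have vE c : zcomb v (c * 'X) = zcomb u (c * 'X).
  rewrite /zcomb; apply: eq_bigr => -[[|i] lt_i] _ /=; last by rewrite /v mulr1z.
  by rewrite coefMX /= !mulr0z.
have [|||K [sK K0 decK]] := @generalized_Bassian_split H H F s j gB sF.
- by move=> h; have [c ->] := s_im h; exists (zcomb u c); [exists c | rewrite sE].
- move=> h; have [c ->] := j_im h; exists (zcomb u (c * 'X)); first by eexists.
  by rewrite sE; apply: etrans (vE c) (esym (zcomb_shift u c)).
- move=> _ [c ->]; rewrite jE => cs0; have /u00 c0 := etrans (esym (zcomb_shift u c)) cs0.
  apply: zcomb_eq0 => i; apply/u_eq0/(u_eq0 i.+1).
  by have := c0 i.+1; rewrite coefMX.
have Fu0 : F (u 0%N) by exists 'X^0; rewrite zcombXn.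
have [y [Fy Ky sy]] := decK _ Fu0.
have [c def_c] := subgrpB sF Fy Fu0.
have yp : y *+ p = u 0%N *+ p.
  apply/subr0_eq; rewrite -mulrnBl def_c -raddfMn; apply: zcomb_eq0 => i.
  have sc0 : s (y - u 0%N) = 0 by rewrite raddfB /= sy subrr.
  rewrite def_c in sc0; have vc0 : zcomb v c = 0 := etrans (esym (sE c)) sc0.
  have ind_v : independent v.
    move=> n q sum0 m lt_mn; rewrite /v -mulrzA.
    apply: (ind_uW n (fun m => a m * q m)) => //.
    suff -> : \sum_(i0 < n) u i0 *~ (a i0 * q i0) = 0 by apply: subgrp0 sW.
    by rewrite -[RHS]sum0; apply: eq_bigr => i0 _; rewrite mulrzA.
  have := independent_zcomb_mod ind_v vc0 i; rewrite /v /a coefMn -[c`_i *+ p]mulr_natr natz.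
  rewrite -mulrzA mulrC; case: eqP => // _; rewrite mulr1 => uc.
  by rewrite mulrzA uc mul0rz.
case/eqP: (nz_un 0%N).
have def_un : u 0%N *+ p ^ k = y *+ p ^ k.
  by rewrite -(subnKC k_gt0) expnD expn1 !mulrnA yp.
rewrite def_un; apply: K0; try exact: subgrpMn.
have su0 : s (u 0%N) = u 0%N *+ p.
  by rewrite -[u 0%N in LHS](zcombXn u) sE; apply: zcombXn.
by rewrite raddfMn /= sy su0 -mulrnA -expnS un1.
Qed.

(** * Finiteness of the primary invariants *)

(** [p ^ j T_p], where [T_p] is the [p]-primary component. *)
Definition primary_multiple (G : zmodType) p j (x : G) : Prop :=
  exists2 y, primary_component p y & x = y *+ p ^ j.

Lemma subgrp_primary_multiple (G : zmodType) p j : subgrp (@primary_multiple G p j).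
Proof.
have [f fE] := ex_muln G (p ^ j).
have [im0 imB] := subgrp_img f (@subgrp_primary G p).
split; first by have [y Py def_0] := im0; exists y; rewrite -?fE.
move=> x x' [y Py def_x] [y' Py' def_x'].
have [||z Pz def_z] := imB x x'; [by exists y; rewrite ?fE|by exists y'; rewrite ?fE|].
by exists z; rewrite // -fE.
Qed.

Lemma primary_multiple_primary (G : zmodType) p j (x : G) :
  primary_multiple p j x -> primary_component p x.
Proof. by case=> y Py ->; apply: (subgrpMn (@subgrp_primary G p)). Qed.

(** A decreasing sequence of finite sets is stationary. *)
Lemma socle_stationary (G : zmodType) p : finite_pred (@socle G p 1) ->
  exists2 k, (0 < k)%N & forall (x : G) j, socle p k x -> socle p j x.
Proof.
move=> [s sP].
have /choice[K KP] : forall x : G, exists K, socle p K x -> forall j, socle p j x.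
  move=> x; have [all_j|/existsNP[K nK]] := pselect (forall j, socle p j x).
    by exists 0%N.
  by exists K => /nK.
exists (\max_(x <- s) K x).+1 => // x j Sx; apply: (KP x).
apply: (socleS _ Sx); apply: leqW; apply: leq_bigmax_seq => //.
by apply: sP; apply: socleS Sx.
Qed.

(** Induction on the order of [x]: the multiple [p ^ j x] of order [p] is divisible
    by all powers of [p], so that a multiple of [p] can be subtracted from [x] to
    lower its order. *)
Lemma primary_multiple_divisible (G : zmodType) p k :
  (forall (x : G) j, socle p k x -> socle p j x) ->
  forall x : G, primary_multiple p k x -> exists2 z, primary_multiple p k z & x = z *+ p.
Proof.
move=> stat x Dx; have [j xj] := primary_multiple_primary Dx.
have sD := @subgrp_primary_multiple G p k.
elim: j x xj Dx => [|j IHj] x xj Dx.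
  by exists 0; [apply: subgrp0 | rewrite mul0rn -xj mulr1n].
have [y Py def_x] := Dx.
have Sxj : socle p k (x *+ p ^ j).
  rewrite /socle -mulrnA -expnSr xj; split=> //; exists (y *+ p ^ j).
  by rewrite def_x -!mulrnA mulnC.
have [_ [y' def_y']] := stat _ (k + j.+1)%N Sxj.
have Dz : primary_multiple p k (y' *+ p ^ k).
  exists y' => //; apply: (@primary_muln _ _ (k + j.+1)).
  by rewrite -def_y'; exists 1%N; rewrite -mulrnA -expnSr.
have [||z Dz' def_z] := IHj (x - y' *+ p ^ k *+ p).
- rewrite mulrnBl def_y' -!mulrnA; apply/eqP; rewrite subr_eq0; apply/eqP.
  by congr (_ *+ _); rewrite expnD expnS !mulnA.
- by apply: subgrpB => //; apply: subgrpMn.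
exists (z + y' *+ p ^ k); first exact: subgrpD.
by rewrite mulrnDl -def_z subrK.
Qed.

(** A nonzero divisible [p]-subgroup [D] is isomorphic to [D / D[p]] by
    multiplication by [p], yet [D[p]] is not a direct summand. *)
Lemma generalized_Bassian_reduced (H : zmodType) p (D : H -> Prop) :
  generalized_Bassian H -> prime p -> subgrp D ->
  (forall x, D x -> primary_component p x) ->
  (forall x, D x -> exists2 y, D y & x = y *+ p) ->
  forall x, D x -> x = 0.
Proof.
move=> gB pr_p sD primD divD x Dx; apply/eqP/negPn/negP => nz_x.
have [n xn] := primD x Dx; have [j [nz_xj xjp]] := socle_neq0 nz_x xn.
have Dxj : D (x *+ p ^ j) by apply: subgrpMn.
have [M [sM _ _ MD0 dec]] : exists M : H -> Prop,
    [/\ subgrp M, forall x, x = 0 -> M x, forall x, M x -> True,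
        forall x, M x -> D x -> x = 0
      & forall h, True -> exists f m, [/\ D f, M m & h = f + m]].
  apply: complement => //; try by move=> y ->.
    exact: subgrp_eq0.
  move=> M sM UM MD0 q h m f pr_q _ _ Df _.
  have [->|ne_qp] := eqVneq q p; first exact: divD.
  have [k fk] := primD f Df; apply: (subgrp_coprime_div sD Df fk).
  by rewrite coprimeXl // prime_coprime // dvdn_prime2 // eq_sym.
have [rho [rhoD _ rho_id _]] := projection sD sM MD0 (fun h => dec h I).
have sB : {morph (fun h => rho h *+ p) : x y / x - y}.
  by move=> y z; rewrite raddfB mulrnBl.
have [s sE] := ex_additive sB.
have [|||K [sK K0 decK]] := @generalized_Bassian_split H H D s rho gB sD.
- by move=> h; exists (rho h); rewrite // !sE rho_id.
- move=> h; have [f Df ->] := divD _ (rhoD h).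
  by exists f; rewrite // sE rho_id.
- by move=> f Df; rewrite rho_id.
have [c Dc def_c] := divD _ Dxj.
have [y [Dy Ky]] := decK c Dc; rewrite !sE !rho_id // -def_c => yp.
case/eqP: nz_xj; apply: K0 => //; first by rewrite sE rho_id.
by rewrite -yp; apply: subgrpMn.
Qed.

(** Some [socle p k] is finite, hence so is [socle p 1] by descent. If [socle p k]
    is stationary from [k] on, [p ^ k T_p] is divisible, hence zero; thus [p T_p] is
    bounded and its elements of order [p] are finite in number. *)
Theorem generalized_Bassian_primary (H : zmodType) p :
  generalized_Bassian H -> prime p -> finite_pred (@primary_multiple H p 1).
Proof.
move=> gB pr_p.
have fin1 : finite_pred (@socle H p 1).
  have [k] := generalized_Bassian_socle gB pr_p.
  elim: k => [|[|k] IHk] //; first by apply: finite_predS => x; apply: socleS.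
  by move=> fin_k; apply/IHk/generalized_Bassian_socle_step.
have [k k_gt0 stat] := socle_stationary fin1.
have killed := generalized_Bassian_reduced gB pr_p (@subgrp_primary_multiple H p k)
  (@primary_multiple_primary H p k) (primary_multiple_divisible stat).
have [f fE] := ex_muln H p.
have finj j : finite_pred (fun x : H => primary_multiple p 1 x /\ x *+ p ^ j = 0).
  elim: j => [|j IHj].
    by exists [:: 0] => x [_]; rewrite mulr1n => ->; rewrite mem_seq1.
  apply: (finite_pred_ker (f := f)).
  - split; first by rewrite mul0rn; split=> //; apply: (subgrp0 (subgrp_primary_multiple _ _ _)).
    move=> x y [Px xj] [Py yj]; rewrite mulrnBl xj yj subrr; split=> //.
    by apply: subgrpB => //; apply: subgrp_primary_multiple.
  - apply: finite_predS IHj => _ [x [Px xj] ->]; rewrite fE; split.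
      by apply: subgrpMn => //; apply: subgrp_primary_multiple.
    by rewrite -mulrnA -expnS.
  - by apply: finite_predS fin1 => x [[[y _ ->] _]]; rewrite fE; split=> //; exists y.
apply: finite_predS (finj k) => x Px; split=> //.
by apply: killed; exists x => //; apply: primary_multiple_primary Px.
Qed.

(** * Decomposition of groups with finite invariants *)

Definition direct_sum (G : zmodType) (A E : G -> Prop) : Prop :=
  [/\ subgrp A, subgrp E, forall x, A x -> E x -> x = 0
    & forall x, exists a e, [/\ A a, E e & x = a + e]].

Definition elementary_pred (G : zmodType) (E : G -> Prop) : Prop :=
  (forall x, E x -> exists2 m, (0 < m)%N & x *+ m = 0) /\
  forall p x, prime p -> E x -> primary_component p x -> x *+ p = 0.

(** The intrinsic description of B+E-groups. *)
Definition finite_invariants (G : zmodType) : Prop :=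
  finite_rank G /\ forall p, prime p -> finite_pred (@primary_multiple G p 1).

Lemma subgrp_muln (G : zmodType) n : subgrp (fun x : G => exists y, x = y *+ n).
Proof.
split; first by exists 0; rewrite mul0rn.
by move=> _ _ [x ->] [y ->]; exists (x - y); rewrite mulrnBl.
Qed.

Lemma subgrp_annihilator (G : zmodType) n : subgrp (fun x : G => x *+ n = 0).
Proof.
by split=> [|x y xn yn]; [rewrite mul0rn | rewrite mulrnBl xn yn subrr].
Qed.

(** The finitely many generators span a finite group modulo [p]. *)
Lemma finite_socle_zspan (G : zmodType) (l : seq G) p :
  prime p -> finite_pred (@primary_multiple G p 1) ->
  finite_pred (fun x : G => x *+ p = 0 /\
    exists c y, [/\ zspan l c, exists z, y = z *+ p & x = c + y]).
Proof.
move=> pr_p finP; have [Q [pi [pi_surj pi0]]] := quotient (@subgrp_muln G p).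
apply: (finite_pred_ker (f := pi)).
- apply: subgrpI; first exact: subgrp_annihilator.
  by apply: subgrpS; [apply: subgrp_zspan | apply: subgrp_muln].
- apply: (finite_predS (Q := zspan (map pi l))); last first.
    apply: finite_zspan => _ /mapP[x _ ->]; exists p; first exact: prime_gt0.
    by rewrite -raddfMn; apply/pi0; exists x.
  move=> _ [x [_ [c [y [[a ->] [z def_y] ->]]]] ->].
  rewrite raddfD [pi y](_ : _ = 0) ?addr0; last by apply/pi0; exists z.
  exists a; rewrite size_map raddf_sum; apply: eq_bigr => i _.
  by rewrite raddfMz (nth_map 0).
- apply: finite_predS finP => x [[xp _] /pi0[y def_x]]; exists y => //.
  by exists 2; rewrite -mulnn mulrnA -def_x.
Qed.

(** At one prime: [E] is a complement in [G[p]] of what the generators and [p G]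
    capture, so that it is at once a direct summand of [G] and of finite index
    in the [p]-torsion. *)
Lemma elementary_projection (G : zmodType) (l : seq G) p :
  prime p -> finite_pred (@primary_multiple G p 1) ->
  exists rho : {additive G -> G},
    [/\ forall x, rho x *+ p = 0, forall x, rho (rho x) = rho x,
        forall x, zspan l x -> rho x = 0
      & finite_pred (fun x => primary_component p x /\ rho x = 0)].
Proof.
move=> pr_p finP.
pose U x := exists c y, [/\ zspan l c, exists z, y = z *+ p & x = c + y].
have sU : subgrp U by apply: subgrpS; [apply: subgrp_zspan | apply: subgrp_muln].
have pU x : U (x *+ p).
  exists 0, (x *+ p); rewrite add0r; split=> //; last by exists x.
  by apply: (subgrp0 (subgrp_zspan _)).
pose S (x : G) := x *+ p = 0; have sS : subgrp S := @subgrp_annihilator G p.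
pose U1 x := S x /\ U x; have sU1 : subgrp U1 := subgrpI sS sU.
have [E [sE _ ES EU0 decS]] : exists E : G -> Prop,
    [/\ subgrp E, forall x, x = 0 -> E x, forall x, E x -> S x,
        forall x, E x -> U1 x -> x = 0
      & forall h, S h -> exists f m, [/\ U1 f, E m & h = f + m]].
  apply: (@homogeneous_complement G S _ U1 p 0) => //; try by move=> x [].
  - exact: subgrp_eq0.
  - by move=> x ->; apply: subgrp0 sS.
  - by move=> f _; rewrite mulr1n => ->; exists 0; [apply: subgrp0 sU1 | rewrite mul0rn].
have [||||||M [sM UM _ ME0 decG]] :=
  @homogeneous_complement G (fun=> True) U E p 0 pr_p (subgrp_all G) sU sE.
- by [].
- by [].
- by move=> x Ux Ex; apply: EU0 => //; split=> //; apply: ES.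
- by move=> x _; apply: pU.
- by move=> f /ES.
- by move=> f _; rewrite mulr1n => ->; exists 0; [apply: subgrp0 sE | rewrite mul0rn].
have [rho [rhoE rhoM rho_id rho0]] := projection sE sM ME0 (fun h => decG h I).
exists rho; split=> [x|x|x lx|].
- exact/ES.
- exact/rho_id.
- apply/rho0/UM; exists x, 0; rewrite addr0; split=> //.
  by exists 0; rewrite mul0rn.
have [f fE] := ex_muln G p; apply: (finite_pred_ker (f := f)).
- apply: subgrpI; first exact: subgrp_primary.
  exact: (subgrp_pre rho (@subgrp_eq0 G)).
- by apply: finite_predS finP => _ [x [Px _] ->]; exists x; rewrite ?fE.
apply: finite_predS (finite_socle_zspan l pr_p finP) => x [[_ rx] /[!fE] xp].
have [u [e [U1u Ee def_x]]] := decS x xp.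
suff e0 : e = 0 by rewrite def_x e0 addr0.
rewrite -(rho_id e Ee); have := rx; rewrite def_x raddfD rho0 ?add0r //.
by case: U1u => _ /UM.
Qed.

(** [A] is the intersection of the kernels of the projections at all primes. A
    nonzero multiple [c x] of an element [x] lies in the span of the generators,
    so that [x] is killed by the projections at all primes not dividing [c];
    subtracting its other projections puts it in [A]. *)
Theorem finite_invariants_decomposition (G : zmodType) :
  finite_invariants G ->
  exists A E : G -> Prop, [/\ direct_sum A E, elementary_pred E
    & forall p, prime p -> finite_pred (fun x => A x /\ primary_component p x)].
Proof.
case=> finR finP; have [l lP] := finite_rank_zspan finR.
have /choice[rho rhoP] : forall p, exists rho : {additive G -> G}, prime p ->
    [/\ forall x, rho x *+ p = 0, forall x, rho (rho x) = rho x,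
        forall x, zspan l x -> rho x = 0
      & finite_pred (fun x => primary_component p x /\ rho x = 0)].
  move=> p; have [pr_p|] := boolP (prime p); last by exists idfun.
  by have [rho rhoP] := elementary_projection l pr_p (finP p pr_p); exists rho.
have rho_p p x : prime p -> rho p x *+ p = 0 by case/rhoP.
have rho_coprime p x n : prime p -> x *+ n = 0 -> coprime p n -> rho p x = 0.
  move=> pr_p xn co_pn; apply: (mulrn_eq0_coprime co_pn); first exact: rho_p.
  by rewrite -raddfMn xn raddf0.
have rho_ev x : exists n, forall p, (n <= p)%N -> prime p -> rho p x = 0.
  have [c nz_c lxc] := lP x; exists `|c|.+1%N => p lt_cp pr_p.
  have [_ _ rho_l _] := rhoP p pr_p.
  apply: (@mulrn_eq0_coprime _ _ p `|c|%N); last 1 first.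
  - apply: (@subgrp_absz _ _ (@subgrp_eq0 G)).
    by rewrite -raddfMz; apply: rho_l.
  - by rewrite prime_coprime // gtnNdvd // absz_gt0.
  - exact: rho_p.
pose A x := forall p, prime p -> rho p x = 0.
pose E x := exists n, (forall p, (n <= p)%N -> prime p -> rho p x = 0) /\
  x = \sum_(p < n | prime p) rho p x.
have widen n m x : (n <= m)%N -> (forall p, (n <= p)%N -> prime p -> rho p x = 0) ->
    \sum_(p < n | prime p) rho p x = \sum_(p < m | prime p) rho p x.
  move=> le_nm rho0; rewrite (big_ord_widen_cond _ prime (fun p => rho p x) le_nm) big_mkcond.
  rewrite [RHS]big_mkcond; apply: eq_bigr => p _.
  by case: (boolP (prime p)) => //= pr_p; case: ltnP => // /rho0 ->.
have sA : subgrp A.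
  split=> [p _|x y Ax Ay p pr_p]; first exact: raddf0.
  by rewrite raddfB Ax ?Ay ?subrr.
have sE : subgrp E.
  split; first by exists 0%N; rewrite big_ord0; split=> // p _ _; apply: raddf0.
  move=> x y [n [xn def_x]] [m [ym def_y]].
  exists (maxn n m); split=> [p|].
    by rewrite geq_max => /andP[/xn xp /ym yp] pr_p; rewrite raddfB xp ?yp ?subrr.
  rewrite {1}def_x {1}def_y (widen _ (maxn n m) x) ?leq_maxl //.
  rewrite (widen _ (maxn n m) y) ?leq_maxr // -sumrB.
  by apply: eq_bigr => p _; rewrite raddfB.
exists A, E; split.
- split=> // [x Ax [n [_ ->]]|x]; first by rewrite big1 // => p; apply: Ax.
  have [n xn] := rho_ev x; pose e := \sum_(p < n | prime p) rho p x.
  have rho_e q : prime q -> rho q e = rho q x.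
    move=> pr_q; rewrite /e raddf_sum.
    have cross p : prime p -> p != q -> rho q (rho p x) = 0.
      move=> pr_p ne_pq; apply: (rho_coprime q _ p) => //; first exact: rho_p.
      by rewrite prime_coprime // dvdn_prime2 // eq_sym.
    have [lt_qn|le_nq] := ltnP q n.
      rewrite (bigD1 (Ordinal lt_qn)) //= big1 ?addr0; first by case: (rhoP q pr_q).
      by move=> p /andP[pr_p]; rewrite -val_eqE; apply: cross.
    rewrite big1 ?xn // => p pr_p; apply: cross => //.
    by rewrite neq_ltn (leq_trans (ltn_ord p)).
  exists (x - e), e; rewrite subrK; split=> // [p pr_p|].
    by rewrite raddfB rho_e ?subrr.
  exists n; split=> [p le_np pr_p|]; first by rewrite rho_e ?xn.
  by apply: eq_bigr => p pr_p; rewrite rho_e.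
- split=> [x [n [_ ->]]|q x pr_q [n [_ def_x]] [k xk]].
    exists n`!; first exact: fact_gt0.
    rewrite -sumrMnl big1 // => p pr_p.
    have /dvdnP[m ->] : (p %| n`!)%N by apply: dvdn_fact; rewrite prime_gt0 // ltnW.
    by rewrite mulnC mulrnA rho_p ?mul0rn.
  rewrite def_x -sumrMnl big1 // => p pr_p.
  have [<-|ne_pq] := eqVneq (p : nat) q; first exact: rho_p.
  rewrite (rho_coprime p x (q ^ k)%N) ?mul0rn //.
  by rewrite coprimeXr // prime_coprime // dvdn_prime2.
- move=> p pr_p; have [_ _ _] := rhoP p pr_p; apply: finite_predS => x [Ax Px].
  by split=> //; apply: Ax.
Qed.

(** * Sufficient conditions for the Bassian properties *)

Lemma torsion_primary_eq0 (G : zmodType) (P : G -> Prop) (x : G) m :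
  subgrp P -> P x -> (0 < m)%N -> x *+ m = 0 ->
  (forall p y, prime p -> P y -> primary_component p y -> y = 0) -> x = 0.
Proof.
move=> sP Px m_gt0 xm P0; elim/ltn_ind: m m_gt0 xm => m IHm m_gt0 xm.
have [m_le1|m_gt1] := leqP m 1%N.
  by move: xm; have -> : m = 1%N by lia.
have [k def_m] := dvdnP (pdiv_dvd m); have pr_q := pdiv_prime m_gt1.
have q_gt1 := prime_gt1 pr_q; apply: (IHm k); [nia|nia|].
apply: (P0 (pdiv m)) => //; first exact: subgrpMn.
by exists 1%N; rewrite expn1 -mulrnA -def_m.
Qed.

(** Counting: a torsion kernel lets [p]-primary elements be lifted to
    [p]-primary ones, so that an embedding [f] maps [p ^ j T_p (G)] into
    [pi (p ^ j T_p (G))], and a finite group does not embed in a proper quotient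
    of itself. *)
Lemma torsion_kernel_primary_multiple (G Q : zmodType) (pi f : {additive G -> Q}) p j :
  prime p -> finite_pred (@primary_multiple G p j) ->
  (forall y, exists x, pi x = y) -> injective f ->
  (forall z, pi z = 0 -> exists2 m, (0 < m)%N & z *+ m = 0) ->
  forall x, pi x = 0 -> primary_multiple p j x -> x = 0.
Proof.
move=> pr_p [s sP] pi_surj inj_f tor x pix Px; apply/eqP/negPn/negP => nz_x.
pose P := @primary_multiple G p j.
(* [f] injects [t] into the image under [pi] of [t] minus [x], since [pi x = pi 0]. *)
pose t := undup [seq y <- s | `[< P y >]].
have tP y : y \in t <-> P y.
  rewrite mem_undup mem_filter; split=> [/andP[/asboolP //]|Py].
  by rewrite sP // andbT; apply/asboolP.
have sub : {subset map f t <= map pi (rem x t)}.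
  move=> _ /mapP[_ /tP[y [k yk] ->] ->]; have [z def_z] := pi_surj (f y).
  pose I u := exists2 z', primary_component p z' & u = pi z'.
  have sI : subgrp I by apply: subgrp_img; apply: subgrp_primary.
  have [m m_gt0 zm] : exists2 m, (0 < m)%N & z *+ p ^ k *+ m = 0.
    by apply: tor; rewrite raddfMn /= def_z -raddfMn yk raddf0.
  have [m' co_m' def_m] := pfactor_coprime pr_p m_gt0.
  have [z' [k' z'k] def_z'] : I (pi z).
    apply: (@subgrp_coprime _ _ sI _ (p ^ k) m').
    - by rewrite coprimeXl.
    - by rewrite def_z -raddfMn yk raddf0; apply: subgrp0 sI.
    exists (z *+ m'); last by rewrite raddfMn.
    exists (k + logn p m)%N; rewrite -zm {2}def_m -!mulrnA expnD.
    by congr (_ *+ _); rewrite mulnCA.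
  have Pz : P (z' *+ p ^ j) by exists z' => //; exists k'.
  rewrite raddfMn /= -def_z def_z' -raddfMn.
  have [->|ne] := eqVneq (z' *+ p ^ j) x.
    rewrite pix -(raddf0 pi); apply: map_f.
    rewrite mem_rem_uniq ?undup_uniq // inE /= eq_sym nz_x.
    by apply/tP; apply: (subgrp0 (subgrp_primary_multiple _ _ _)).
  apply: map_f; rewrite mem_rem_uniq ?undup_uniq // inE /= ne.
  exact/tP.
have uniq_f : uniq (map f t) by rewrite map_inj_uniq // undup_uniq.
have := uniq_leq_size uniq_f sub.
have tx : x \in t by apply/tP.
rewrite !size_map size_rem // leqNgt prednK ?leqnn //.
by case: (t) tx.
Qed.

(** The kernel is torsion by finite rank, and its primary components vanish by
    counting. *)
Theorem Bassian_criterion (A : zmodType) :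
  finite_rank A -> (forall p, prime p -> finite_pred (@primary_component A p)) ->
  Bassian A.
Proof.
move=> finA finP N [f inj_f] x Nx; have [pi [pi_surj pi0]] := quotP N.
have tor z : pi z = 0 -> exists2 m, (0 < m)%N & z *+ m = 0.
  exact: (finite_rank_torsion_kernel _ pi_surj inj_f).
have [m m_gt0 xm] := tor x ((pi0 x).2 Nx).
apply: (torsion_primary_eq0 (subgrp_zmodClosed N) Nx m_gt0 xm) => p y pr_p Ny Py.
apply: (torsion_kernel_primary_multiple (j := 0) pr_p _ pi_surj inj_f tor).
- apply: finite_predS (finP p pr_p) => z; exact: primary_multiple_primary.
- exact/pi0.
- by exists y.
Qed.

(** Counting in [p T_p] shows that [N] avoids [p T_p]; since [B[p]] consists of
    multiples of [p], also [N & B = 0]. Then [N] has a complement containing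
    [B], because [H / B] is elementary. *)
Theorem generalized_Bassian_criterion (H : zmodType) (B E : H -> Prop) :
  direct_sum B E -> elementary_pred E -> finite_rank H ->
  (forall p, prime p -> finite_pred (fun x => B x /\ primary_component p x)) ->
  (forall p x, prime p -> B x -> x *+ p = 0 -> exists2 y, B y & x = y *+ p) ->
  generalized_Bassian H.
Proof.
move=> [sB sE BE0 decBE] [torE elE] finH finB divB N [f inj_f].
have [pi [pi_surj pi0]] := quotP N; have sN := subgrp_zmodClosed N.
have tor z : pi z = 0 -> exists2 m, (0 < m)%N & z *+ m = 0.
  exact: (finite_rank_torsion_kernel _ pi_surj inj_f).
have finpT p : prime p -> finite_pred (@primary_multiple H p 1).
  move=> pr_p; apply: finite_predS (finite_pred_img (fun x => x *+ p) (finB p pr_p)).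
  move=> _ [y [k yk] ->]; have [b [e [Bb Ee def_y]]] := decBE y.
  have bk : b *+ p ^ k = 0.
    apply: BE0; first exact: subgrpMn.
    have := subgrpMn sE (p ^ k) (subgrpN sE Ee); rewrite mulNrn.
    by have /eqP := yk; rewrite def_y mulrnDl addr_eq0 => /eqP ->.
  exists b; first by split=> //; exists k.
  rewrite def_y mulrnDl [e *+ _](elE p) ?addr0 //; exists k.
  by have := yk; rewrite def_y mulrnDl bk add0r.
have NpT p x : prime p -> x \in N -> primary_multiple p 1 x -> x = 0.
  move=> pr_p /pi0.
  exact: (torsion_kernel_primary_multiple pr_p (finpT p pr_p) pi_surj inj_f tor).
have BN0 x : B x -> x \in N -> x = 0.
  move=> Bx Nx; have [m m_gt0 xm] := tor x ((pi0 x).2 Nx).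
  apply: (torsion_primary_eq0 (subgrpI sB sN) (conj Bx Nx) m_gt0 xm).
  move=> p y pr_p [By Ny] [k yk]; apply/eqP/negPn/negP => nz_y.
  have [j [nz_yj yjp]] := socle_neq0 nz_y yk.
  case/eqP: nz_yj; apply: (NpT p) => //; first exact: (@subgrpMn _ _ sN).
  have [z Bz def_z] := divB p (y *+ p ^ j) pr_p (subgrpMn sB _ By) yjp.
  by exists z => //; exists 2; rewrite -mulnn mulrnA -def_z.
have [//|//|M sM BM MN0 q h m g pr_q _ Mm Ng def_qh|M [sM BM _ MN0 dec]] :=
  complement (subgrp_all H) sB sN _ _ BN0.
  have [b [e [Bb Ee def_h]]] := decBE h; have [n n_gt0 en] := torE e Ee.
  have [r co_qr def_n] := pfactor_coprime pr_q n_gt0.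
  have er : e *+ r *+ q = 0.
    apply: elE => //; first exact: subgrpMn.
    by exists (logn q n); rewrite -mulrnA -def_n.
  apply: (subgrp_coprime_div sN Ng (a := r)); last by rewrite coprime_sym.
  apply: MN0; last exact: (subgrpMn sN).
  apply: (subgrp_addKr sM (subgrpMn sM r Mm)); rewrite -mulrnDl -def_qh.
  rewrite def_h -mulrnA mulnC mulrnA mulrnDl mulrnDl er addr0.
  by apply: BM; do 2!apply: (subgrpMn sB).
have [K KP] := ex_zmodClosed sM; exists K; split=> [x Nx /KP Mx|x].
  exact: MN0.
by have [n [k [Nn Mk def_x]]] := dec x I; exists n, k; split=> //; apply/KP.
Qed.

(** * Divisible hulls *)

Lemma subgroupP (G : zmodType) (N : zmodClosed G) :
  exists v : {additive subgroup N -> G},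
    [/\ injective v, forall z, v z \in N & forall x, x \in N -> exists z, v z = x].
Proof.
exists (\val : {additive subgroup N -> G}); split; first exact: val_inj.
- by move=> z; apply: valP.
- by move=> x Nx; exists (Sub x Nx); apply: SubK.
Qed.

(** The group [rat / int] is a divisible cogenerator: a nonzero [a] of order [m]
    is detected by [a |-> 1 / m], and one of infinite order by [a |-> 1 / 2]. *)
Lemma divisible_cogenerator : exists2 T : zmodType, divisible T &
  forall (A : zmodType) (a : A), a != 0 -> exists chi : {additive A -> T}, chi a != 0.
Proof.
have sZ : subgrp (fun x : rat => exists z : int, x = z%:~R).
  split; first by exists 0.
  by move=> _ _ [x ->] [y ->]; exists (x - y); rewrite rmorphB.
have [T [pi [pi_surj pi0]]] := quotient sZ.
have divT : divisible T.
  move=> n x n_gt0; have [y <-] := pi_surj x; exists (pi (y / n%:R)).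
  have nz_n : n%:R != 0 :> rat by rewrite pnatr_eq0 -lt0n.
  by rewrite -raddfMn -[in RHS](divfK nz_n y) mulr_natr.
exists T => // A a nz_a.
have [m [m_gt1 mP]] : exists m, (1 < m)%N /\ forall c : int, a *~ c = 0 -> (m %| `|c|)%N.
  have [tor_a|inf_a] := pselect (exists m, (0 < m)%N && (a *+ m == 0)).
    case: (ex_minnP tor_a) => m /andP[m_gt0 /eqP am] min_m; exists m; split.
      rewrite ltn_neqAle m_gt0 andbT eq_sym.
      by apply: contra_neq nz_a => m1; rewrite -am m1 mulr1n.
    move=> c /(subgrp_absz (@subgrp_eq0 A)) ac; have := mulrn_eq0_gcd ac am.
    have g_gt0 : (0 < gcdn `|c| m)%N by rewrite gcdn_gt0 m_gt0 orbT.
    move=> /eqP ag; have := min_m _ (introT andP (conj g_gt0 ag)) => le_mg.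
    have /eqP <- : gcdn `|c| m == m by rewrite eqn_leq le_mg dvdn_leq ?dvdn_gcdr.
    exact: dvdn_gcdl.
  exists 2; split=> // c /(subgrp_absz (@subgrp_eq0 A)) /eqP ac.
  suff -> : `|c|%N = 0%N by [].
  by apply/eqP; rewrite -leqn0 leqNgt; apply/negP => c_gt0; case: inf_a; exists `|c|%N; rewrite c_gt0.
have m_neq0 : m%:R != 0 :> rat by rewrite pnatr_eq0; lia.
have eB : {morph (fun c : int => a *~ c) : x y / x - y} by move=> x y; rewrite mulrzBr.
have gB : {morph (fun c : int => pi (c%:~R / m%:R)) : x y / x - y}.
  by move=> x y; rewrite rmorphB /= mulrBl raddfB.
have [e eE] := ex_additive eB; have [g gE] := ex_additive gB.
have [c|chi chiE] := divisible_extension (e := e) (g := g) divT.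
  rewrite eE gE => /mP m_c; have /intdiv.dvdzP[k ->] : (m%:Z %| c)%Z by [].
  by apply/pi0; exists k; rewrite rmorphM /= -pmulrn mulfK.
exists chi; apply/eqP => chi_a; have := chiE 1; rewrite eE gE mulr1z chi_a.
move=> /esym/pi0[z]; rewrite mul1r => def_z.
have : (1 : int) = z * m%:Z.
  by apply: (@intr_inj rat); rewrite rmorphM /= -pmulrn -def_z mulVf.
by move=> /(congr1 absz); rewrite abszM /= => /esym/eqP; rewrite muln_eq1; lia.
Qed.

(** Homomorphisms to the divisible cogenerator separate the elements of [A]. *)
Lemma embeds_divisible (A : zmodType) :
  exists2 D : zmodType, divisible D & embeds A D.
Proof.
have [T divT cogen] := divisible_cogenerator.
pose D : zmodType := {additive A -> T} -> T.
pose ev (a : A) : D := fun chi => chi a.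
have evB : {morph ev : x y / x - y}.
  by move=> x y; apply/funext => chi; rewrite /ev raddfB.
exists D.
  move=> n x n_gt0; have /choice[y yP] : forall chi, exists y, y *+ n = x chi.
    by move=> chi; apply: divT.
  exists (y : D); apply/funext => chi; rewrite -yP.
  by elim: (n) => // k IHk; rewrite !mulrS -IHk.
have [j jE] := ex_additive evB; exists j; apply: raddf_inj => a; rewrite jE => ev0.
apply/eqP/negPn/negP => /cogen[chi /eqP]; apply.
exact: (congr1 (fun x => x chi) ev0).
Qed.

(** Dividing a divisible overgroup by a maximal subgroup disjoint from [A] makes
    the extension essential. *)
Lemma divisible_hull (A : zmodType) :
  exists (D : zmodType) (j : {additive A -> D}), [/\ divisible D, injective j
    & forall x, x != 0 -> exists (n : int) (a : A), x *~ n = j a /\ j a != 0].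
Proof.
have [D0 divD0 [j0 inj_j0]] := embeds_divisible A.
have [|M [sM _ _ Mj0 maxM]] := maximal_disjoint (S := fun=> True)
  (V := fun x => exists a, x = j0 a) (subgrp_all D0) (@subgrp_eq0 D0) (fun _ _ => I).
  by [].
have [D [pi [pi_surj pi0]]] := quotient sM.
exists D, (pi \o j0); split.
- move=> n x n_gt0; have [y <-] := pi_surj x; have [z <-] := divD0 n y n_gt0.
  by exists (pi z); rewrite raddfMn.
- apply: raddf_inj => a /pi0 Mja; apply: inj_j0; rewrite raddf0.
  by apply: Mj0 => //; exists a.
move=> x nz_x; have [y def_x] := pi_surj x; rewrite -def_x in nz_x *.
have [/pi0 y0|m [c [Mm [a def_a] nz]]] := maxM y I; first by rewrite y0 eqxx in nz_x.
exists c, a; rewrite /= -def_a -raddfMz raddfD.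
have -> : pi m = 0 by apply/pi0.
rewrite add0r; split=> //; apply: contra_neq nz => /pi0 My; apply: Mj0; last by exists a.
exact: subgrpD.
Qed.

(** Multiplication by [p] has kernel [D[p]], which lies in [A] because a nonzero
    multiple of an element of order [p] generates the same subgroup. *)
Lemma hull_annihilator_finite (A D : zmodType) (j : {additive A -> D}) p e :
  prime p -> injective j ->
  (forall x, x != 0 -> exists (n : int) (a : A), x *~ n = j a /\ j a != 0) ->
  finite_pred (@primary_component A p) -> finite_pred (fun x : D => x *+ p ^ e = 0).
Proof.
move=> pr_p inj_j ess finA; elim: e => [|e IHe].
  by exists [:: 0] => x; rewrite mulr1n => ->; rewrite mem_seq1.
have [f fE] := ex_muln D p; apply: (finite_pred_ker (f := f)).
- exact: subgrp_annihilator.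
- by apply: finite_predS IHe => _ [x xe ->]; rewrite fE -mulrnA -expnS.
apply: finite_predS (finite_pred_img j finA) => x [_]; rewrite fE => xp.
have [->|/ess[n [a [xn nz_a]]]] := eqVneq x 0.
  by exists 0; rewrite ?raddf0 //; apply: (subgrp0 (subgrp_primary _ _)).
have [a' def_x] : exists a', x = j a'.
  have sj := subgrp_range j; apply: (@subgrp_coprime _ _ sj x p `|n|%N).
  - rewrite prime_coprime //; apply: contra_neqN nz_a => p_n.
    by rewrite -xn; apply: (@mulrz_dvd_eq0 _ p 0); rewrite expn1.
  - by rewrite xp; apply: subgrp0 sj.
  - by apply: (subgrp_absz sj); exists a.
exists a' => //; exists 1%N; apply: inj_j.
by rewrite raddfMn -def_x raddf0 expn1.
Qed.

(** The torsion elements whose [p]-primary components have exponent dividing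
    [p ^ e p]. *)
Definition bounded_torsion (G : zmodType) (e : nat -> nat) (t : G) : Prop :=
  exists2 m : nat, (0 < m)%N & t *+ m = 0 /\ forall p, prime p -> (logn p m <= e p)%N.

Lemma subgrp_bounded_torsion (G : zmodType) e : subgrp (@bounded_torsion G e).
Proof.
split; first by exists 1%N => //; rewrite mul0rn; split=> // p _; rewrite logn1.
move=> x y [m m_gt0 [xm me]] [n n_gt0 [yn ne]].
exists (lcmn m n); first by rewrite lcmn_gt0 m_gt0.
have kill (z : G) d : z *+ d = 0 -> (d %| lcmn m n)%N -> z *+ lcmn m n = 0.
  by move=> zd /dvdnP[k ->]; rewrite mulnC mulrnA zd mul0rn.
split=> [|p pr_p]; last by rewrite logn_lcm // geq_max me ?ne.
by rewrite mulrnBl (kill x m) ?(kill y n) ?subrr ?dvdn_lcml ?dvdn_lcmr.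
Qed.

Lemma bounded_torsion_primary (G : zmodType) e p (t : G) :
  prime p -> bounded_torsion e t -> primary_component p t -> t *+ p ^ e p = 0.
Proof.
move=> pr_p [m m_gt0 [tm me]] [k tk]; have := mulrn_eq0_gcd tk tm.
have /(dvdn_pfactor _ _ pr_p)[v _ def_v] := dvdn_gcdl (p ^ k) m.
rewrite def_v => tv; rewrite -(subnKC (leq_trans _ (me p pr_p) : v <= e p)%N).
  by rewrite expnD mulrnA tv mul0rn.
by rewrite -pfactor_dvdn // -def_v dvdn_gcdr.
Qed.

Lemma primary_bounded_torsion (G : zmodType) e p (t : G) :
  prime p -> t *+ p ^ e p = 0 -> bounded_torsion e t.
Proof.
move=> pr_p te; exists (p ^ e p)%N; first by rewrite expn_gt0 prime_gt0.
split=> // q pr_q; rewrite lognX logn_prime //.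
by have [->|] := eqVneq q p; rewrite ?muln1 ?muln0.
Qed.

(** * Characterization of B+E-groups *)

(** Given [G = A + E] as in the decomposition, enlarge [A] inside its divisible
    hull [D] to [B = A + W], where [W] consists of torsion elements whose
    [p]-part has exponent dividing [p ^ e p], the bound [e p] being at least [2]
    and sufficient for [A]. Then [B] has finite rank, its [p]-torsion is the
    annihilator of [p ^ e p] in [D], and [B[p]] is contained in [p B]. *)
Theorem finite_invariants_embeds (G : zmodType) : finite_invariants G ->
  exists H : zmodType, generalized_Bassian H /\ embeds G H.
Proof.
move=> invG; have finG := invG.1.
have [A [E [[sA sE AE0 decG] elE finA]]] := finite_invariants_decomposition invG.
have [Q [pi [pi_surj pi0]]] := quotient sE.
have [D [j [divD inj_j ess]]] := divisible_hull Q.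
pose J : {additive G -> D} := j \o pi.
have J0 g : J g = 0 <-> E g.
  rewrite -pi0 /=; split=> [jg|->]; last exact: raddf0.
  by apply: inj_j; rewrite raddf0.
have liftA x : exists2 a, A a & pi a = x.
  have [g <-] := pi_surj x; have [a [e [Aa Ee ->]]] := decG g.
  by exists a; rewrite // raddfD [pi e](pi0 e).2 // addr0.
have finQ p : prime p -> finite_pred (@primary_component Q p).
  move=> pr_p; apply: finite_predS (finite_pred_img pi (finA p pr_p)) => x [k].
  have [a Aa <-] := liftA x; rewrite -raddfMn => /pi0 Eak; exists a => //.
  by split=> //; exists k; apply: AE0 => //; apply: subgrpMn.
have /choice[e eP] : forall p, exists e, prime p ->
    (1 < e)%N /\ forall a, A a -> primary_component p a -> a *+ p ^ e = 0.
  move=> p; have [pr_p|] := boolP (prime p); last by exists 0%N.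
  have [s sP] := finA p pr_p.
  have /choice[K KP] : forall x : G, exists K, primary_component p x -> x *+ p ^ K = 0.
    by move=> x; have [[k xk]|nPx] := pselect (primary_component p x);
      [exists k | exists 0%N].
  exists (\max_(x <- s) K x).+2 => _; split=> // a Aa Pa.
  have le_K : (K a <= (\max_(x <- s) K x).+2)%N.
    by do 2!apply: leqW; apply: leq_bigmax_seq => //; apply: sP.
  by rewrite -(subnKC le_K) expnD mulrnA KP // mul0rn.
pose W : D -> Prop := bounded_torsion e; have sW : subgrp W := @subgrp_bounded_torsion D e.
pose B x := exists y t, [/\ exists g, y = J g, W t & x = y + t].
have sB : subgrp B by apply: subgrpS => //; apply: subgrp_range.
have WB t : W t -> B t.
  by move=> Wt; exists 0, t; rewrite add0r; split=> //; exists 0; rewrite raddf0.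
have JB g : B (J g).
  by exists (J g), 0; rewrite addr0; split=> //; [exists g | apply: subgrp0 sW].
have WA m a : (0 < m)%N -> A a -> a *+ m = 0 -> W (J a).
  elim/ltn_ind: m a => m IHm a m_gt0 Aa am.
  have [m_le1|m_gt1] := leqP m 1%N.
    have -> : a = 0 by move: am; have -> : m = 1%N by lia.
    by rewrite raddf0; apply: subgrp0 sW.
  have pr_p := pdiv_prime m_gt1; have [m' co_m' def_m] := pfactor_coprime pr_p m_gt0.
  set p := pdiv m in pr_p co_m' def_m; have p_gt1 := prime_gt1 pr_p.
  have log_gt0 : (0 < logn p m)%N by rewrite logn_gt0 mem_primes pr_p m_gt0 pdiv_dvd.
  have pl_gt1 : (1 < p ^ logn p m)%N by rewrite -(exp1n (logn p m)) ltn_exp2r.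
  apply: (@subgrp_coprime _ _ sW _ (p ^ logn p m) m'); first by rewrite coprimeXl.
    rewrite -raddfMn; apply: (IHm m'); [nia|nia|exact: subgrpMn|].
    by rewrite -mulrnA mulnC -def_m.
  rewrite -raddfMn; apply: (primary_bounded_torsion pr_p).
  rewrite -raddfMn (eP p pr_p).2 ?raddf0 //; first exact: subgrpMn.
  by exists (logn p m); rewrite -mulrnA -def_m.
have primB p x : prime p -> B x -> primary_component p x -> x *+ p ^ e p = 0.
  move=> pr_p [_ [t [[g ->] Wt ->]]] [k xk].
  have [a [e' [Aa Ee' def_g]]] := decG g.
  have Jg : J g = J a by rewrite def_g raddfD [J e'](J0 e').2 // addr0.
  have [n n_gt0 [tn _]] := Wt.
  apply: (bounded_torsion_primary pr_p _ (ex_intro _ k xk)).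
  apply: subgrpD => //; rewrite Jg; apply: (WA (p ^ k * n)%N) => //.
    by rewrite muln_gt0 n_gt0 expn_gt0 prime_gt0.
  apply: AE0; first exact: subgrpMn.
  apply/J0; rewrite raddfMn -Jg -[J g](addrK t) mulrnBl mulrnA xk mul0rn.
  by rewrite mulnC mulrnA tn mul0rn subrr.
have divB p x : prime p -> B x -> x *+ p = 0 -> exists2 y, B y & x = y *+ p.
  move=> pr_p Bx xp; have [y def_y] := divD p x (prime_gt0 pr_p).
  exists y => //; apply: WB; apply: (primary_bounded_torsion pr_p).
  have [e_gt1 _] := eP p pr_p.
  by rewrite -(subnKC e_gt1) expnD -mulnn !mulrnA def_y xp mul0rn.
(* The overgroup is the external direct sum of [B] and [E]. *)
pose P (z : (D * G)%type) := B z.1 /\ E z.2.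
have sP : subgrp P.
  split; first by split; apply: subgrp0.
  by move=> x y [Bx Ex] [By Ey]; split; apply: subgrpB.
have [N NP] := ex_zmodClosed sP; have [v [inj_v vN v_surj]] := subgroupP N.
have vP z : P (v z) by apply/NP.
have lift x g : B x -> E g -> exists z, v z = (x, g).
  by move=> Bx Eg; apply/v_surj/NP.
have B0 := subgrp0 sB; have E0 := subgrp0 sE.
have fst0 : subgrp (fun z : (D * G)%type => z.1 = 0).
  by split=> // x y /= -> ->; rewrite subr0.
have snd0 : subgrp (fun z : (D * G)%type => z.2 = 0).
  by split=> // x y /= -> ->; rewrite subr0.
have MnE (z : (D * G)%type) n : z *+ n = (z.1 *+ n, z.2 *+ n).
  by rewrite (surjective_pairing (z *+ n)) !raddfMn.
have vMn z n : v (z *+ n) = ((v z).1 *+ n, (v z).2 *+ n) by rewrite raddfMn /= MnE.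
have v_eq0 z : v z = 0 -> z = 0 by move=> vz; apply: inj_v; rewrite vz raddf0.
exists (subgroup N); split.
  apply: (generalized_Bassian_criterion (B := fun z => (v z).2 = 0)
            (E := fun z => (v z).1 = 0)).
  - split; [exact: (subgrp_pre v snd0)|exact: (subgrp_pre v fst0)| |].
      by move=> z z2 z1; apply: v_eq0; case: (v z) z1 z2 => /= ? ? -> ->.
    move=> z; have [Bz Ez] := vP z.
    have [[b vb] [c vc]] := (lift _ _ Bz E0, lift _ _ B0 Ez).
    exists b, c; rewrite vb vc; split=> //; apply: inj_v; rewrite raddfD /= vb vc.
    by case: (v z) => x g; congr pair; rewrite /= ?addr0 ?add0r.
  - split=> [z z1|p z pr_p z1 [k zk]].
      have [_ Ez] := vP z; have [m m_gt0 zm] := elE.1 _ Ez.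
      by exists m => //; apply: v_eq0; rewrite vMn z1 zm mul0rn.
    have [_ Ez] := vP z; apply: v_eq0; rewrite vMn z1 mul0rn (elE.2 p) //.
    by exists k; have := congr1 v zk; rewrite vMn raddf0 => /(congr1 snd).
  - have eB : {morph (fun g : G => (J g, 0 : G)) : x y / x - y}.
      by move=> x y; rewrite raddfB; congr pair; rewrite subr0.
    have [e' e'E] := ex_additive eB.
    apply: (@finite_rank_commensurable G (subgroup N) (D * G)%type e' v) => // z.
    have [[_ [t [[g ->] [n n_gt0 [tn _]] def_z1]]] Ez] := vP z.
    have [m m_gt0 zm] := elE.1 _ Ez; exists (n * m)%N%:Z.
      by rewrite -lt0n muln_gt0 n_gt0.
    exists (g *+ (n * m)); rewrite e'E -pmulrn MnE def_z1 raddfMn; congr pair.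
      by rewrite mulrnDl [t *+ _]mulrnA tn mul0rn addr0.
    by rewrite mulnC mulrnA zm mul0rn.
  - move=> p pr_p; apply: (finite_pred_ker (f := v)).
    + apply: subgrpI (@subgrp_primary _ p); exact: (subgrp_pre v snd0).
    + have fin := hull_annihilator_finite (e p) pr_p inj_j ess (finQ p pr_p).
      apply: finite_predS (finite_pred_img (fun x : D => (x, 0 : G)) fin).
      move=> _ [z [z2 [k zk]] ->]; exists (v z).1; last by case: (v z) z2 => ? ? /= ->.
      have [Bz _] := vP z; apply: primB => //; exists k.
      by have := congr1 v zk; rewrite vMn raddf0 => /(congr1 fst).
    + by exists [:: 0] => z [_ /v_eq0 ->]; rewrite mem_seq1.
  - move=> p z pr_p z2 zp; have [Bz _] := vP z.
    have [||y By def_y] := divB p (v z).1 pr_p => //.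
      by have := congr1 v zp; rewrite vMn raddf0 => /(congr1 fst).
    have [y' vy'] := lift y 0 By E0; exists y'; first by rewrite vy'.
    apply: inj_v; rewrite vMn vy' mul0rn -def_y.
    by case: (v z) z2 => ? ? /= ->.
have [rho [rhoE rhoA rho_id _]] := projection sE sA AE0
  (fun h => let: ex_intro a (ex_intro b (And3 Aa Eb def_h)) := decG h in
            ex_intro _ b (ex_intro _ a (And3 Eb Aa (etrans def_h (addrC _ _))))).
have /choice[f fP] g : exists z, v z = (J g, rho g) by apply: lift.
have fB : {morph f : x y / x - y}.
  by move=> x y; apply: inj_v; rewrite raddfB /= !fP !raddfB.
have [F FE] := ex_additive fB; exists F; apply: raddf_inj => g; rewrite FE => fg.
have := fP g; rewrite fg raddf0 => -[/esym/J0 Eg rg].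
by rewrite -(rho_id g Eg) -rg.
Qed.

Lemma finite_invariants_sub (G H : zmodType) :
  embeds G H -> finite_invariants H -> finite_invariants G.
Proof.
move=> emb [finH finpH]; split; first exact: finite_rank_embeds emb finH.
have [f inj_f] := emb => p pr_p; apply: (finite_pred_ker (f := f)).
- exact: subgrp_primary_multiple.
- apply: finite_predS (finpH p pr_p) => _ [_ [y [k yk] ->] ->].
  by exists (f y); rewrite ?raddfMn //; exists k; rewrite -raddfMn yk raddf0.
- by exists [:: 0] => x [_ fx]; rewrite mem_seq1; apply/eqP/inj_f; rewrite fx raddf0.
Qed.

Theorem generalized_Bassian_finite_invariants (H : zmodType) :
  generalized_Bassian H -> finite_invariants H.
Proof.
move=> gB; split; first exact: generalized_Bassian_finite_rank.
by move=> p; apply: generalized_Bassian_primary.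
Qed.

Lemma Bassian_generalized (A : zmodType) : Bassian A -> generalized_Bassian A.
Proof.
move=> bA N /(bA N) N0; have [K KP] := ex_zmodClosed (subgrp_all A).
exists K; split=> [x /N0 //|x].
by exists 0, x; rewrite add0r; split=> //; [apply: rpred0 | apply/KP].
Qed.

Lemma BE_group_finite_invariants (G : zmodType) : BE_group G -> finite_invariants G.
Proof.
move=> [A [E [[AE0 decG] /Bassian_generalized/generalized_Bassian_finite_invariants
  [finA finpA] [torE elE]]]].
have [va [inj_va vaA va_surj]] := subgroupP A.
have [ve [inj_ve veE ve_surj]] := subgroupP E.
split.
  apply: (@finite_rank_commensurable (subgroup A) G G va idfun) => // g.
  have [a [e [/va_surj[a' <-] /ve_surj[e' <-] ->]]] := decG g.
  have [m m_gt0 em] := torE e'; exists m%:Z; first by rewrite -lt0n.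
  by exists (a' *+ m); rewrite -pmulrn mulrnDl -(raddfMn ve) em raddf0 addr0 raddfMn.
move=> p pr_p; apply: finite_predS (finite_pred_img va (finpA p pr_p)).
move=> _ [y [k yk] ->]; have [a [e [Aa Ee def_y]]] := decG y.
have ak : a *+ p ^ k = 0.
  apply: AE0; first exact: rpredMn.
  have /eqP := yk; rewrite def_y mulrnDl addr_eq0 => /eqP ->.
  by rewrite rpredN rpredMn.
have ek : e *+ p ^ k = 0 by have := yk; rewrite def_y mulrnDl ak add0r.
have [[a' def_a] [e' def_e]] := (va_surj a Aa, ve_surj e Ee).
have ep : e' *+ p = 0.
  by apply: elE => //; exists k; apply: inj_ve; rewrite raddfMn /= def_e ek raddf0.
exists (a' *+ p ^ 1).
  by exists a' => //; exists k; apply: inj_va; rewrite raddfMn /= def_a ak raddf0.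
by rewrite def_y mulrnDl -def_e -(raddfMn ve) ep raddf0 addr0 raddfMn /= def_a.
Qed.

Lemma finite_invariants_BE_group (G : zmodType) : finite_invariants G -> BE_group G.
Proof.
move=> invG; have [A [E [[sA sE AE0 decG] [torE elE] finA]]] :=
  finite_invariants_decomposition invG.
have [[A' A'P] [E' E'P]] := (ex_zmodClosed sA, ex_zmodClosed sE).
have [va [inj_va vaA _]] := subgroupP A'.
have [ve [inj_ve veE _]] := subgroupP E'.
exists A', E'; split.
- split=> [x /A'P Ax /E'P Ex|x]; first exact: AE0.
  by have [a [e [Aa Ee ->]]] := decG x; exists a, e; split=> //; [apply/A'P|apply/E'P].
- apply: Bassian_criterion.
    by apply: finite_rank_embeds invG.1; exists va.
  move=> p pr_p; apply: (finite_pred_ker (f := va)).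
  + exact: subgrp_primary.
  + apply: finite_predS (finA p pr_p) => _ [x [k xk] ->]; split; first exact/A'P.
    by exists k; rewrite -raddfMn xk raddf0.
  + by exists [:: 0] => x [_ vx]; rewrite mem_seq1; apply/eqP/inj_va; rewrite vx raddf0.
- split=> [x|p pr_p x [k xk]].
    have [m m_gt0 xm] := torE (ve x) ((E'P _).1 (veE x)).
    by exists m => //; apply: inj_ve; rewrite raddfMn /= xm raddf0.
  apply: inj_ve; rewrite raddfMn raddf0; apply: elE => //; first exact/E'P.
  by exists k; rewrite -raddfMn xk raddf0.
Qed.

Theorem corollary4p10 (G : zmodType) :
  BE_group G <-> exists H : zmodType, generalized_Bassian H /\ embeds G H.
Proof.
split=> [/BE_group_finite_invariants|[H [gB emb]]].
  exact: finite_invariants_embeds.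
apply: finite_invariants_BE_group; apply: (finite_invariants_sub emb).
exact: generalized_Bassian_finite_invariants.
Qed.
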